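(* Let $\mathcal H$ be an infinite-dimensional separable complex Hilbert space, let $p,q\in[1,\infty]$ be conjugate, and let $C\in\mathcal B^p(\mathcal H)$, $T\in\mathcal B^q(\mathcal H)$ both be self-adjoint. Let the positive semi-definite operators $C^+,T^+$ and $C^-,T^-$ denote the positive and negative parts of $C,T$, respectively (i.e. $C=C^+-C^-$, $T=T^+-T^-$). Then $$\sup_{U\in\mathcal U(\mathcal H)}\operatorname{tr}(CU^\dagger TU)=\sum_{j=1}^\infty\big(\lambda_j^\downarrow(C^+)\lambda_j^\downarrow(T^+)+\lambda_j^\downarrow(C^-)\lambda_j^\downarrow(T^-)\big)$$ and $$\inf_{U\in\mathcal U(\mathcal H)}\operatorname{tr}(CU^\dagger TU)=-\sum_{j=1}^\infty\big(\lambda_j^\downarrow(C^+)\lambda_j^\downarrow(T^-)+\lambda_j^\downarrow(C^-)\lambda_j^\downarrow(T^+)\big).$$ In particular, $$-\sum_{j=1}^\infty\big(\lambda_j^\downarrow(C^+)\lambda_j^\downarrow(T^-)+\lambda_j^\downarrow(C^-)\lambda_j^\downarrow(T^+)\big)\le\operatorname{tr}(CT)\le\sum_{j=1}^\infty\big(\lambda_j^\downarrow(C^+)\lambda_j^\downarrow(T^+)+\lambda_j^\downarrow(C^-)\lambda_j^\downarrow(T^-)\big).$$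
   Context: $\mathcal U(\mathcal H)$ denotes the set of unitary operators on $\mathcal H$, and $\dagger$ the adjoint. The exponents $p,q\in[1,\infty]$ are conjugate if $\frac1p+\frac1q=1$ (with $\frac1\infty=0$). For $p\in[1,\infty)$, the Schatten class $\mathcal B^p(\mathcal H)$ is the set of compact operators $C$ on $\mathcal H$ whose singular numbers satisfy $\sum_n s_n(C)^p<\infty$; $\mathcal B^\infty(\mathcal H)$ is the set of all compact operators on $\mathcal H$. The positive and negative parts $A^{\pm}$ of a self-adjoint operator $A$ are those given by the functional calculus, $A^{\pm}=\frac12(|A|\pm A)$ (so $A^+A^-=0$). For a positive semi-definite compact operator $A$, $(\lambda_j^\downarrow(A))_{j\in\mathbb N}$ is its sequence of eigenvalues sorted in decreasing order: the non-zero eigenvalues in decreasing order, repeated according to multiplicity, filled up with zeros if there are only finitely many of them. *)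

(* Defs.v *)
From HB Require Import structures.
From mathcomp Require Export all_boot all_order all_algebra.
From mathcomp Require Export complex.
From mathcomp Require Export all_classical all_reals all_analysis.

Set Implicit Arguments.
Unset Strict Implicit.
Unset Printing Implicit Defensive.

Import Order.TTheory GRing.Theory Num.Theory.
Import numFieldNormedType.Exports.

Local Open Scope classical_set_scope.
Local Open Scope ring_scope.
Local Open Scope complex_scope.

(* On R[i], the order x <= y means that y - x is a nonnegative real number, and
   norms are elements of R[i]. *)

Definition separable_space (T : topologicalType) : Prop :=
  exists2 D : set T, countable D & dense D.

Section Dimension.
Context {R : realType} {H : lmodType R[i]}.

Definition has_dim (V : set H) (n : nat) : Prop :=
  exists b : 'I_n -> H,
    (forall c : 'I_n -> R[i],
       \sum_(i < n) c i *: b i = 0 -> forall i, c i = 0) /\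
    V = [set x | exists c : 'I_n -> R[i], x = \sum_(i < n) c i *: b i].

Definition infinite_dimensional : Prop := forall n, ~ has_dim [set: H] n.

Definition eigenspace (A : H -> H) (mu : R) : set H :=
  [set x | A x = mu%:C *: x].

(* Meant for a positive semidefinite compact A, whose non-zero eigenvalues are
   positive: each mu > 0 occurs in lam as many times as the dimension of its
   eigenspace, and all other entries of lam are zero. Indices start at 0. *)
Definition is_eigenvalue_seq (A : H -> H) (lam : nat -> R) : Prop :=
  [/\ nonincreasing_seq lam,
      forall j, 0 <= lam j &
      forall mu : R, 0 < mu -> exists2 n : nat,
        has_dim (eigenspace A mu) n & ([set j | lam j = mu] #= `I_n)%card].

Definition eigenvalue_seq (A : H -> H) : nat -> R :=
  get [set lam : nat -> R | is_eigenvalue_seq A lam].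

End Dimension.

Arguments infinite_dimensional {R} H.

Section Operators.
Context {R : realType} {H : completeNormedModType R[i]}.
(* linear in the first argument, conjugate-linear in the second one *)
Variable dot : {dot H for Num.conj}.

(* get picks an element of a set, which for the sets below has exactly one
   element whenever the operators are bounded (trace: trace-class). *)

Definition adjoint (A : H -> H) : H -> H :=
  get [set B : H -> H | forall x y, dot (A x) y = dot x (B y)].

Definition selfadjoint (A : H -> H) : Prop := adjoint A = A.

Definition unitary (U : H -> H) : Prop :=
  [/\ linear U, continuous U, adjoint U \o U = id & U \o adjoint U = id].

(* A positive operator on a complex Hilbert space is self-adjoint. *)
Definition positive_semidefinite (A : H -> H) : Prop :=
  [/\ linear A, continuous A & forall x, 0 <= dot (A x) x].

(* functional calculus: the unique positive square root of adjoint A \o A *)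
Definition abs_op (A : H -> H) : H -> H :=
  get [set B : H -> H | positive_semidefinite B /\ B \o B = adjoint A \o A].

Definition pos_part (A : H -> H) : H -> H := fun x => 2^-1 *: (abs_op A x + A x).
Definition neg_part (A : H -> H) : H -> H := fun x => 2^-1 *: (abs_op A x - A x).

Definition compact_op (A : H -> H) : Prop :=
  linear A /\ precompact (A @` [set x | `|x| <= 1]).

Definition singular_numbers (A : H -> H) : nat -> R := eigenvalue_seq (abs_op A).

Definition schatten (p : \bar R) (A : H -> H) : Prop :=
  compact_op A /\
  match p with
  | r%:E => (\sum_(0 <= n <oo) (singular_numbers A n `^ r)%:E < +oo)%E
  | +oo%E => True
  | -oo%E => False
  end.

(* In an infinite-dimensional separable Hilbert space, every orthonormal basis
   (maximal orthonormal family) can be indexed by nat. *)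
Definition orthonormal_basis (e : nat -> H) : Prop :=
  (forall m n, dot (e m) (e n) = (m == n)%:R) /\
  (forall x, (forall n, dot x (e n) = 0) -> x = 0).

(* Since the order of a basis is arbitrary, convergence along all the
   orthonormal bases is absolute, and among the bounded operators it holds
   exactly for the trace-class ones. *)
Definition is_trace (A : H -> H) (t : R[i]) : Prop :=
  forall e : nat -> H, orthonormal_basis e ->
    (\sum_(k < n) dot (A (e k)) (e k) : R[i]^o) @[n --> \oo] --> (t : R[i]^o).

Definition trace (A : H -> H) : R[i] := get [set t : R[i]^o | is_trace A t].

End Operators.

(* Main.v *)
Require Import Defs.
From mathcomp Require Import ring lra finmap.
Import Order.TTheory GRing.Theory Num.Theory.
Import numFieldNormedType.Exports.
Local Open Scope classical_set_scope.
Local Open Scope ring_scope.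
Local Open Scope complex_scope.

Set Implicit Arguments.
Unset Strict Implicit.
Unset Printing Implicit Defensive.

(** Diagonalize [C = sum_i c_i |f_i><f_i|] and [T = sum_j t_j |g_j><g_j|] along
    orthonormal sequences, with [|c_i|] and [|t_j|] decreasing
    ([spectral_theorem]); their absolute values and their positive and negative
    parts are diagonal along the same sequences, so all the eigenvalue sequences
    in question are decreasing rearrangements of [|c|], [c^+], [c^-] and so on
    ([schatten_diagonalization]).  The summability conditions on [C] and [T]
    enter only through [sum_k |c_k| |t_k| < oo], which is Young's inequality
    ([hoelder_bounded]).  Conjugating [T] by a unitary [U] replaces the [g_j] by
    [U^* g_j], another orthonormal sequence.

    Everything rests on one inequality ([substochastic_le]): if [a] and [b] are
    nonnegative and decreasing and [D] is a nonnegative matrix with row and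
    column sums at most one, then [sum_ij a_i b_j D_ij <= sum_k a_k b_k].  It is
    used twice.

    For [D_ij = |<K f_i, g_j>| |<g_j, f_i>|], where [K] is any symmetric
    contraction, it shows that [sum_i c_i <K f_i, T f_i>] converges absolutely
    and uniformly in [K].  Taking for [K] the projections on the first vectors of
    an arbitrary basis, one finds that the trace of [C T] exists and equals
    [sum_ij c_i t_j |<f_i, g_j>|^2] ([trace_expansion]).

    For [D_ij = |<f_i, g_j>|^2], applied to the pairs [c^+], [t^+] and [c^-],
    [t^-] after sorting, it gives the upper bound ([trace_upper]).

    The bound is approached, though in general not attained: match the leading
    eigenvectors of equal sign, send the other leading eigenvectors of [C] to
    eigenvectors of [T] with tiny eigenvalues, and extend this finite assignment
    to a unitary by Householder reflections ([matching_unitary],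
    [trace_approach]).  The remaining terms of the trace are small by the uniform
    convergence.  The infimum follows by replacing [T] with [-T]. *)

(** * Real-valued norms over the complex scalars *)

Section RealNorm.
Context {R : realType}.

(** The norms of the normed space are complex numbers; suprema and limits of
    inequalities are handled on their real parts. *)
Definition rn (V : normedZmodType R[i]) (x : V) : R := complex.Re `|x|.

Lemma rnE (V : normedZmodType R[i]) (x : V) : (rn x)%:C = `|x|.
Proof. by rewrite /rn RRe_real// normr_real. Qed.

Lemma rn_ge0 (V : normedZmodType R[i]) (x : V) : 0 <= rn x.
Proof. by rewrite -lecR rnE normr_ge0. Qed.

Lemma rn0 (V : normedZmodType R[i]) : rn (0 : V) = 0.
Proof. by rewrite /rn normr0. Qed.

Lemma rn_eq0 (V : normedZmodType R[i]) (x : V) : (rn x == 0) = (x == 0).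
Proof. by rewrite -[RHS]normr_eq0 -(rnE x) -(inj_eq (@complexI R)). Qed.

Lemma rnN (V : normedZmodType R[i]) (x : V) : rn (- x) = rn x.
Proof. by rewrite /rn normrN. Qed.

Lemma rnBC (V : normedZmodType R[i]) (x y : V) : rn (x - y) = rn (y - x).
Proof. by rewrite -rnN opprB. Qed.

Lemma rnD (V : normedZmodType R[i]) (x y : V) : rn (x + y) <= rn x + rn y.
Proof. by rewrite -lecR rmorphD/= !rnE ler_normD. Qed.

Lemma rn_sum (V : normedZmodType R[i]) I (r : seq I) (P : pred I) (F : I -> V) :
  rn (\sum_(i <- r | P i) F i) <= \sum_(i <- r | P i) rn (F i).
Proof.
elim/big_ind2 : _ => [|x a y b xa yb|//]; first by rewrite rn0.
by apply: le_trans (rnD _ _) _; apply: lerD.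
Qed.

Lemma rnM (a b : R[i]) : rn (a * b) = rn a * rn b.
Proof. by apply: complexI; rewrite rmorphM/= !rnE normrM. Qed.

Lemma rnR (t : R) : rn t%:C = `|t|.
Proof. by rewrite /rn normc_def/= expr0n addr0 sqrtr_sqr. Qed.

Lemma rn_conj (a : R[i]) : rn (Num.conj a) = rn a.
Proof. by rewrite /rn norm_conjC. Qed.

Lemma ger0_rnE (a : R[i]) : 0 <= a -> (complex.Re a)%:C = a.
Proof. by move=> a0; rewrite RRe_real// ger0_real. Qed.

Lemma rn_sqr (a : R[i]) : (rn a ^+ 2)%:C = a * Num.conj a.
Proof. by rewrite rmorphXn/= rnE normCK. Qed.

Lemma conjR (t : R) : Num.conj t%:C = t%:C.
Proof. exact: conjc_real. Qed.

Lemma Re_le_rn (a : R[i]) : complex.Re a <= rn a.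
Proof. by rewrite -lecR rnE (le_trans _ (normc_ge_Re _))// lecR ler_norm. Qed.

End RealNorm.
#[global] Hint Extern 0 (is_true (_ <= rn _)) => solve [exact: rn_ge0] : core.

(** * Inner product geometry *)

Section Inner.
Context {R : realType} {H : completeNormedModType R[i]}.
Variable dot : {dot H for Num.conj}.
Hypothesis norm_dot : forall x : H, `|x| ^+ 2 = dot x x.
Local Notation "''[' u , v ]" := (dot u%R v%R) : ring_scope.
Implicit Types (x y z : H) (a b : R[i]).

Lemma rnZ a x : rn (a *: x : H) = rn a * rn x.
Proof. by apply: complexI; rewrite rmorphM/= !rnE normrZ. Qed.

Lemma dotC x y : '[x, y] = Num.conj '[y, x].
Proof. by rewrite hermC/= expr0 mul1r. Qed.
Lemma dotDl x y z : '[x + y, z] = '[x, z] + '[y, z].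
Proof. by rewrite linearDl. Qed.
Lemma dotDr x y z : '[x, y + z] = '[x, y] + '[x, z].
Proof. by rewrite linearDr. Qed.
Lemma dotNl x y : '[- x, y] = - '[x, y].
Proof. by rewrite linearNl. Qed.
Lemma dotNr x y : '[x, - y] = - '[x, y].
Proof. by rewrite linearNr. Qed.
Lemma dotBl x y z : '[x - y, z] = '[x, z] - '[y, z].
Proof. by rewrite dotDl dotNl. Qed.
Lemma dotBr x y z : '[x, y - z] = '[x, y] - '[x, z].
Proof. by rewrite dotDr dotNr. Qed.
Lemma dotZl a x y : '[a *: x, y] = a * '[x, y].
Proof. by rewrite linearZl_LR. Qed.
Lemma dotZr a x y : '[x, a *: y] = Num.conj a * '[x, y].
Proof. by rewrite linearZr_LR. Qed.
Lemma dot0l x : '[0, x] = 0.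
Proof. by rewrite linear0l. Qed.
Lemma dot0r x : '[x, 0] = 0.
Proof. by rewrite linear0r. Qed.
Lemma dot_suml I (r : seq I) (P : pred I) (F : I -> H) y :
  '[\sum_(i <- r | P i) F i, y] = \sum_(i <- r | P i) '[F i, y].
Proof. by apply: (big_morph (dot^~ y)) => [u v|]; [exact: dotDl|exact: dot0l]. Qed.
Lemma dot_sumr I (r : seq I) (P : pred I) (F : I -> H) y :
  '[y, \sum_(i <- r | P i) F i] = \sum_(i <- r | P i) '[y, F i].
Proof. by apply: (big_morph (dot y)) => [u v|]; [exact: dotDr|exact: dot0r]. Qed.

Lemma dotxx x : '[x, x] = (rn x ^+ 2)%:C.
Proof. by rewrite -norm_dot rmorphXn/= rnE. Qed.

Lemma dot_eq0 x : '[x, x] = 0 -> x = 0.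
Proof.
rewrite dotxx => /complexI/eqP; rewrite sqrf_eq0 rn_eq0.
by move/eqP.
Qed.

Lemma dot_inj x y : (forall z, '[x, z] = '[y, z]) -> x = y.
Proof.
by move=> xy; apply/subr0_eq/dot_eq0; rewrite dotBl xy subrr.
Qed.

Lemma rn_dotC x y : rn '[x, y] = rn '[y, x].
Proof. by rewrite dotC rn_conj. Qed.

Lemma rnD_sqr x y : rn (x + y) ^+ 2 = rn x ^+ 2 + rn y ^+ 2 + 2 * complex.Re '[x, y].
Proof.
apply: complexI; rewrite -dotxx dotDl !dotDr !dotxx (dotC y x).
rewrite !(rmorphD, rmorphM)/= [(complex.Re '[x,y])%:C]ReJ_add.
rewrite rmorph1 -mulr2n [X in _ = _ + X]mulrC divfK ?pnatr_eq0//.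
change (('[x, y]^*)%C) with (Num.conj '[x, y]); ring.
Qed.

Lemma pythagoras x y : '[x, y] = 0 -> rn (x + y) ^+ 2 = rn x ^+ 2 + rn y ^+ 2.
Proof. by move=> xy; rewrite rnD_sqr xy mulr0 addr0. Qed.

Lemma CauchySchwarz x y : rn '[x, y] <= rn x * rn y.
Proof.
have [->|y0] := eqVneq y 0; first by rewrite dot0r !rn0 mulr0.
have ry : 0 < rn y by rewrite lt_neqAle eq_sym rn_eq0 y0 rn_ge0.
pose t := '[x, y] / '[y, y].
have yy0 : '[y, y] != 0.
  by rewrite dotxx -(rmorph0 (real_complex R)) (inj_eq (@complexI R)) sqrf_eq0 rn_eq0.
have o : '[x - t *: y, t *: y] = 0.
  by rewrite dotZr dotBl dotZl /t divfK// subrr mulr0.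
have := pythagoras o; rewrite subrK => e.
have : rn (t *: y) ^+ 2 <= rn x ^+ 2 by rewrite e lerDr sqr_ge0.
rewrite ler_sqr ?nnegrE// rnZ => h.
have -> : '[x, y] = t * '[y, y] by rewrite /t divfK.
rewrite rnM dotxx rnR ger0_norm ?sqr_ge0// expr2 mulrA.
by rewrite ler_wpM2r.
Qed.

End Inner.

(** * Limits of sequences *)

Section RealSeries.
Context {R : realType}.

(** Bounded partial sums of nonnegative terms come close to their supremum; this
    is the source of all the tail estimates below. *)
Lemma bounded_series_tail (x : nat -> R) (M : R) :
  (forall i, 0 <= x i) -> (forall n, \sum_(i < n) x i <= M) ->
  forall e, 0 < e -> exists N, forall n, \sum_(i < n) x i < \sum_(i < N) x i + e.
Proof.
move=> x0 xM e e0; pose A := [set s | exists n, s = \sum_(i < n) x i].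
have hA : has_sup A.
  split; first by exists (\sum_(i < 0) x i); exists 0%N.
  by exists M => _ [n ->].
have [_ [N ->] h] := sup_adherent e0 hA.
exists N => n; rewrite -ltrBlDr; apply: le_lt_trans h.
by rewrite lerB//; apply: sup_upper_bound => //; exists n.
Qed.

End RealSeries.

Section Tends.
Context {R : realType}.

(** Convergence of sequences with real tolerances, for the norms with values in
    [R[i]] carried both by the Hilbert space and by the scalars themselves. *)
Definition tends (V : normedZmodType R[i]) (u : nat -> V) (l : V) :=
  forall e : R, 0 < e -> exists N, forall n, (N <= n)%N -> rn (u n - l) < e.

Lemma tends_cst (V : normedZmodType R[i]) (l : V) : tends (fun=> l) l.
Proof. by move=> e e0; exists 0%N => n _; rewrite subrr rn0. Qed.

Lemma tendsD (V : normedZmodType R[i]) (u v : nat -> V) l m :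
  tends u l -> tends v m -> tends (fun n => u n + v n) (l + m).
Proof.
move=> ul vm e e0; have e2 : 0 < e / 2 by rewrite divr_gt0.
have [N hN] := ul _ e2; have [M hM] := vm _ e2.
exists (maxn N M) => n; rewrite geq_max => /andP[/hN h1 /hM h2].
rewrite [X in rn X](_ : _ = (u n - l) + (v n - m)); last by rewrite opprD addrACA.
by rewrite (splitr e) (le_lt_trans (rnD _ _))// ltrD.
Qed.

Lemma tendsN (V : normedZmodType R[i]) (u : nat -> V) l :
  tends u l -> tends (fun n => - u n) (- l).
Proof.
move=> ul e e0; have [N hN] := ul _ e0; exists N => n /hN.
by rewrite -opprD rnN.
Qed.

Lemma tendsB (V : normedZmodType R[i]) (u v : nat -> V) l m :
  tends u l -> tends v m -> tends (fun n => u n - v n) (l - m).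
Proof. by move=> ul vm; apply: tendsD => //; exact: tendsN. Qed.

Lemma tends_sum (V : normedZmodType R[i]) k (u : 'I_k -> nat -> V) l :
  (forall i, tends (u i) (l i)) -> tends (fun n => \sum_i u i n) (\sum_i l i).
Proof.
elim: k u l => [|k IH] u l h.
  under eq_fun do rewrite big_ord0.
  by rewrite big_ord0; exact: tends_cst.
under eq_fun do rewrite big_ord_recl.
by rewrite big_ord_recl; apply: tendsD => //; apply: IH.
Qed.

Lemma tends_rn_le (V : normedZmodType R[i]) (u : nat -> V) l M :
  tends u l -> (exists N, forall n, (N <= n)%N -> rn (u n) <= M) -> rn l <= M.
Proof.
move=> ul [N uM]; rewrite leNgt; apply/negP => Ml.
have [|N' hN] := ul (rn l - M); first by rewrite subr_gt0.
have := hN (maxn N N') (leq_maxr _ _); have := uM (maxn N N') (leq_maxl _ _).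
set v := u _ => h1 h2; have := rnD (l - v) v; rewrite subrK rnBC; lra.
Qed.

Lemma tends_unique (V : normedZmodType R[i]) (u : nat -> V) l m :
  tends u l -> tends u m -> l = m.
Proof.
move=> ul um; apply/subr0_eq/eqP; rewrite -rn_eq0 eq_le rn_ge0 andbT.
apply: (tends_rn_le (tendsB ul um)).
by exists 0%N => n _; rewrite subrr rn0.
Qed.

Lemma tends_Re_ge0 (u : nat -> R[i]) l :
  tends u l -> (forall n, 0 <= u n) -> 0 <= l.
Proof.
move=> ul u0; suff -> : l = `|l| by exact: normr_ge0.
apply: (tends_unique ul) => e e0; have [N hN] := ul _ e0; exists N => n /hN.
apply: le_lt_trans; rewrite -(ger0_norm (u0 n)) -lecR !rnE.
by rewrite ger0_norm// -[X in X - `|l|]ger0_norm// ler_dist_dist.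
Qed.

Lemma tendsMl (u : nat -> R[i]) l (a : R[i]) :
  tends u l -> tends (fun n => a * u n) (a * l).
Proof.
move=> ul e e0; have a1 : 0 < rn a + 1 by rewrite ltr_wpDl.
have [|N hN] := ul (e / (rn a + 1)); first by rewrite divr_gt0.
exists N => n /hN; rewrite -mulrBr rnM ltr_pdivlMr// mulrC; apply: le_lt_trans.
by rewrite ler_wpM2r// lerDl.
Qed.

Lemma cvg_tendsP (H : normedModType R[i]) (u : nat -> H) l :
  (u @ \oo --> l) <-> tends u l.
Proof.
split=> [/cvgrPdist_lt h e e0|h].
  have [|N _ hN] := h e%:C; first by rewrite ltcR.
  by exists N => n /hN/=; rewrite -rnE ltcR rnBC.
apply/cvgrPdist_lt => e e0.
have er : (complex.Re e)%:C = e by rewrite ger0_rnE// ltW.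
have [|N hN] := h (complex.Re e); first by rewrite -ltcR er.
by exists N => // n /hN; rewrite -er -rnE ltcR rnBC.
Qed.

Lemma cauchy_tends (H : completeNormedModType R[i]) (u : nat -> H) :
  (forall e : R, 0 < e -> exists N, forall n, (N <= n)%N -> rn (u n - u N) < e) ->
  exists l, tends u l.
Proof.
move=> h; suff /cvg_ex[l ul] : cvg (u @ \oo) by exists l; exact/cvg_tendsP.
apply/cauchy_cvgP; apply: cauchy_exP => e e0.
have er : (complex.Re e)%:C = e by rewrite ger0_rnE// ltW.
have [|N hN] := h (complex.Re e); first by rewrite -ltcR er.
exists (u N), N => // n /hN /=.
by rewrite -ball_normE/= -er -rnE ltcR rnBC.
Qed.

Lemma additive_bounded_continuous (H : normedModType R[i]) (A : H -> H) (M : R) :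
  (forall x y, A (x - y) = A x - A y) -> (forall x, rn (A x) <= M * rn x) ->
  continuous A.
Proof.
move=> Ab AM x; apply/cvgrPdist_lt => e e0.
have er : (complex.Re e)%:C = e by rewrite ger0_rnE// ltW.
near=> y.
have M0 : 0 < `|M| + 1 by rewrite ltr_wpDl.
rewrite -Ab -er -rnE ltcR.
have h : rn (x - y) < complex.Re e / (`|M| + 1).
  rewrite -ltcR rnE; near: y.
  have := @nbhsx_ballx _ _ x (complex.Re e / (`|M| + 1))%:C.
  rewrite -ball_normE; apply; by rewrite ltcR divr_gt0// -ltcR er.
apply: le_lt_trans (AM _) _; move: h; rewrite ltr_pdivlMr// mulrC.
apply: le_lt_trans; rewrite ler_wpM2r//.
by apply: le_trans (ler_norm _) _; rewrite lerDl.
Unshelve. all: by end_near. Qed.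

End Tends.

(** * Orthonormal sequences and diagonal operators *)

Section Orthonormal.
Context {R : realType} {H : completeNormedModType R[i]}.
Variable dot : {dot H for Num.conj}.
Hypothesis norm_dot : forall x : H, `|x| ^+ 2 = dot x x.
Local Notation "''[' u , v ]" := (dot u%R v%R) : ring_scope.

Definition orthonormal_seq (f : nat -> H) := forall i j, '[f i, f j] = (i == j)%:R.

Definition perp (f : nat -> H) (x : H) := forall i, '[x, f i] = 0.

Lemma tends_dotl (u : nat -> H) l y : tends u l -> tends (fun n => '[u n, y]) '[l, y].
Proof.
move=> ul e e0; have y1 : 0 < rn y + 1 by rewrite ltr_wpDl.
have [|N hN] := ul (e / (rn y + 1)); first by rewrite divr_gt0.
exists N => n /hN; rewrite -dotBl ltr_pdivlMr//; apply: le_lt_trans.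
by apply: le_trans (CauchySchwarz norm_dot _ _) _; rewrite ler_wpM2l// lerDl.
Qed.

Lemma tends_dotr (u : nat -> H) l y : tends u l -> tends (fun n => '[y, u n]) '[y, l].
Proof.
move=> ul e /(tends_dotl y ul)[N hN]; exists N => n /hN.
by rewrite -dotBr -dotBl rn_dotC.
Qed.

Section Family.
Variable f : nat -> H.
Hypothesis of_ : orthonormal_seq f.

Lemma orthonormal_rn i : rn (f i) = 1.
Proof.
have := of_ i i; rewrite dotxx// eqxx => /complexI/eqP.
by rewrite sqrp_eq1 ?rn_ge0// => /eqP.
Qed.

Lemma dot_comb (u : nat -> R[i]) n j :
  '[\sum_(i < n) u i *: f i, f j] = if (j < n)%N then u j else 0.
Proof.
rewrite dot_suml.
under eq_bigr do rewrite dotZl of_.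
case: ltnP => jn.
  rewrite (bigD1 (Ordinal jn))//= eqxx mulr1 big1 ?addr0// => i ij.
  by rewrite (_ : (_ == _) = false) ?mulr0//; apply: contraNF ij => /eqP ij; apply/eqP/val_inj.
rewrite big1// => i _; rewrite (_ : (_ == _) = false) ?mulr0//.
by apply/negbTE; rewrite neq_ltn (leq_trans (ltn_ord i) jn).
Qed.

Lemma rn_comb_diff (u : nat -> R[i]) m k :
  rn (\sum_(i < m + k) u i *: f i - \sum_(i < m) u i *: f i) ^+ 2 =
  \sum_(i < m + k) rn (u i) ^+ 2 - \sum_(i < m) rn (u i) ^+ 2.
Proof.
elim: k => [|k IH]; first by rewrite addn0 !subrr rn0 expr0n.
rewrite addnS !big_ord_recr/= addrAC (pythagoras norm_dot).
  by rewrite IH rnZ orthonormal_rn mulr1 addrAC.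
by rewrite dotZr dotBl !dot_comb ltnn ltnNge leq_addr subr0 mulr0.
Qed.

Lemma rn_comb (u : nat -> R[i]) n :
  rn (\sum_(i < n) u i *: f i) ^+ 2 = \sum_(i < n) rn (u i) ^+ 2.
Proof. by have := rn_comb_diff u 0 n; rewrite !big_ord0 !subr0. Qed.

Lemma bessel x n : \sum_(i < n) rn '[x, f i] ^+ 2 <= rn x ^+ 2.
Proof.
set S := \sum_(i < n) '[x, f i] *: f i.
have o : '[x - S, S] = 0.
  rewrite dot_sumr big1// => i _; rewrite dotZr dotBl (dot_comb (fun i => '[x, f i])).
  by rewrite ltn_ord subrr mulr0.
have := pythagoras norm_dot o; rewrite subrK => ->.
by rewrite (rn_comb (fun i => '[x, f i])) lerDr sqr_ge0.
Qed.

(** By Pythagoras the tails of the vector series are as small as the tails of the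
    numerical series of squares, so completeness gives the sum. *)
Lemma riesz_fischer (u : nat -> R[i]) (M : R) :
  (forall n, \sum_(i < n) rn (u i) ^+ 2 <= M) ->
  exists y, tends (fun n => \sum_(i < n) u i *: f i) y.
Proof.
move=> uM; apply: cauchy_tends => e e0.
have [N hN] := bounded_series_tail (fun i => sqr_ge0 (rn (u i))) uM (exprn_gt0 2 e0).
exists N => n Nn; rewrite -(@ltr_pXn2r _ 2)// ?nnegrE// ?ltW//.
rewrite -(subnKC Nn) rn_comb_diff ltrBlDl.
exact: hN.
Qed.

Lemma tends_comb_dot (u : nat -> R[i]) y :
  tends (fun n => \sum_(i < n) u i *: f i) y -> forall j, '[y, f j] = u j.
Proof.
move=> uy j; apply: (tends_unique (tends_dotl (f j) uy)) => e e0.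
by exists j.+1 => n jn; rewrite dot_comb jn subrr rn0.
Qed.

(** Every vector splits into its projection on the closed span of [f] and a part
    orthogonal to [f]; operators are compared on the two parts separately. *)
Lemma projection x :
  exists2 y, tends (fun n => \sum_(i < n) '[x, f i] *: f i) y & perp f (x - y).
Proof.
have [y hy] := riesz_fischer (u := fun i => '[x, f i]) (bessel x).
by exists y => // i; rewrite dotBl (tends_comb_dot (u := fun i => '[x, f i]) hy) subrr.
Qed.

End Family.

(** Linearity is a consequence, by nondegeneracy of the inner product. *)
Definition symmetric_op (A : H -> H) := forall x y, '[A x, y] = '[x, A y].

(** The spectral form [A = sum_i a_i |f_i><f_i|].  The orthonormal family is infinite
    but in general incomplete; zero eigenvalues may occur in it, which covers
    operators of finite rank. *)
Definition diagonal (A : H -> H) (a : nat -> R) (f : nat -> H) :=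
  [/\ symmetric_op A, forall i, A (f i) = (a i)%:C *: f i &
      forall x, perp f x -> A x = 0].

Lemma sym_add A : symmetric_op A -> forall x y, A (x + y) = A x + A y.
Proof.
by move=> As x y; apply: (dot_inj norm_dot) => z; rewrite dotDl !As dotDl.
Qed.

Lemma sym_scale A : symmetric_op A -> forall a x, A (a *: x) = a *: A x.
Proof.
by move=> As a x; apply: (dot_inj norm_dot) => z; rewrite dotZl !As dotZl.
Qed.

Lemma sym_opp A : symmetric_op A -> forall x, A (- x) = - A x.
Proof. by move=> As x; rewrite -scaleN1r sym_scale// scaleN1r. Qed.

Lemma sym_sub A : symmetric_op A -> forall x y, A (x - y) = A x - A y.
Proof. by move=> As x y; rewrite sym_add// sym_opp. Qed.

Lemma sym_0 A : symmetric_op A -> A 0 = 0.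
Proof. by move=> As; rewrite -[X in A X](subrr 0) sym_sub// subrr. Qed.

Lemma sym_real A : symmetric_op A -> forall x, '[A x, x] = (complex.Re '[A x, x])%:C.
Proof.
move=> As x; rewrite RRe_real//; apply/CrealP.
by rewrite -dotC As.
Qed.

(** Replace [x] by its projection on the span of [f], which changes nothing in
    [A x], and move [A] to the other side in the partial sums. *)
Lemma diagonal_expansion A a f : orthonormal_seq f -> diagonal A a f ->
  forall x y, tends (fun n => \sum_(i < n) (a i)%:C * '[x, f i] * '[f i, y]) '[A x, y].
Proof.
move=> of_ [As Af A0] x y.
have [z hz pz] := projection of_ x.
have -> : '[A x, y] = '[z, A y].
  by rewrite -As; apply: (congr1 (dot^~ y)); apply/subr0_eq; rewrite -sym_sub// A0.
have := tends_dotl (A y) hz; congr tends; apply/funext => n.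
rewrite dot_suml; apply: eq_bigr => i _.
by rewrite dotZl -As Af dotZl mulrCA mulrA.
Qed.

(** Matrix coefficients determine an operator; hence identities such as
    [|A| |A| = A A] can be read off the eigenvalues. *)
Lemma diagonal_inj A B a f : orthonormal_seq f -> diagonal A a f -> diagonal B a f ->
  A = B.
Proof.
move=> of_ Ad Bd; apply/funext => x; apply: (dot_inj norm_dot) => y.
exact: tends_unique (diagonal_expansion of_ Ad x y) (diagonal_expansion of_ Bd x y).
Qed.

Lemma diagonal_comp A B a b f :
  diagonal A a f -> diagonal B b f -> A \o B = B \o A ->
  diagonal (A \o B) (fun i => a i * b i) f.
Proof.
move=> [As Af A0] [Bs Bf B0] AB; split.
- by move=> x y; rewrite /= As Bs -/((B \o A) y) -AB.
- by move=> i /=; rewrite Bf sym_scale// Af scalerA mulrC rmorphM.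
- by move=> x /B0/= ->; exact: sym_0.
Qed.

Lemma diagonal_comb A B a b (s t : R) f : diagonal A a f -> diagonal B b f ->
  diagonal (fun x => s%:C *: A x + t%:C *: B x) (fun i => s * a i + t * b i) f.
Proof.
move=> [As Af A0] [Bs Bf B0]; split.
- by move=> x y; rewrite dotDl dotDr !dotZl !dotZr !conjR As Bs.
- by move=> i; rewrite Af Bf !scalerA -scalerDl rmorphD !rmorphM.
- by move=> x px; rewrite A0// B0// !scaler0 addr0.
Qed.

(** The sum of the series [sum_i a_i <x, f_i> f_i].  It provides the absolute
    value of a diagonal operator. *)
Lemma diagonal_exists (a : nat -> R) (M : R) f : orthonormal_seq f ->
  (forall i, `|a i| <= M) ->
  exists A, [/\ diagonal A a f, linear A & continuous A].
Proof.
move=> of_ aM.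
have M0 : 0 <= M by apply: le_trans (aM 0%N).
have bnd x n : \sum_(i < n) rn ((a i)%:C * '[x, f i]) ^+ 2 <= (M * rn x) ^+ 2.
  rewrite exprMn; apply: le_trans (_ : M ^+ 2 * \sum_(i < n) rn '[x, f i] ^+ 2 <= _); last first.
    by rewrite ler_wpM2l ?sqr_ge0 ?bessel.
  rewrite mulr_sumr ler_sum// => i _; rewrite rnM exprMn ler_wpM2r ?sqr_ge0//.
  by rewrite rnR ler_sqr ?nnegrE.
have ex x : {y | tends (fun n => \sum_(i < n) ((a i)%:C * '[x, f i]) *: f i) y}.
  exact/cid/(riesz_fischer of_ (u := fun i => (a i)%:C * '[x, f i]) (bnd x)).
pose A x := sval (ex x).
have At x : tends (fun n => \sum_(i < n) ((a i)%:C * '[x, f i]) *: f i) (A x).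
  exact: (svalP (ex x)).
have As : symmetric_op A.
  move=> x y; apply: (tends_unique (tends_dotl y (At x))).
  have := tends_dotr x (At y); congr tends; apply/funext => n.
  rewrite dot_suml dot_sumr; apply: eq_bigr => i _.
  rewrite dotZl dotZr rmorphM/= conjR (dotC dot y) conjCK; ring.
have Ab x : rn (A x) <= M * rn x.
  apply: (tends_rn_le (At x)); exists 0%N => n _.
  rewrite -(@ler_pXn2r _ 2)// ?nnegrE ?mulr_ge0//.
  by rewrite (rn_comb of_ (fun i => (a i)%:C * '[x, f i])).
exists A; split.
- split=> // [i|x px].
  + apply: (tends_unique (At (f i))) => e e0; exists i.+1 => n ni.
    rewrite (bigD1 (Ordinal ni))//= of_ eqxx mulr1 big1 ?addr0 ?subrr ?rn0// => j ji.
    rewrite of_ (_ : (_ == _) = false) ?mulr0 ?scale0r//.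
    by apply: contraNF ji => /eqP ij; apply/eqP/val_inj.
  + apply: (tends_unique (At x)); move=> e e0; exists 0%N => n _.
    by rewrite big1 ?subrr ?rn0// => i _; rewrite px mulr0 scale0r.
- by move=> c x y; rewrite sym_add// sym_scale.
- by apply: (@additive_bounded_continuous _ _ _ M) => // x y; rewrite sym_sub.
Qed.

Lemma diagonal_positive A a f : orthonormal_seq f -> diagonal A a f ->
  (forall i, 0 <= a i) -> forall x, 0 <= '[A x, x].
Proof.
move=> of_ Ad a0 x; apply: (tends_Re_ge0 (diagonal_expansion of_ Ad x x)) => n.
apply: sumr_ge0 => i _; rewrite -mulrA (dotC dot (f i)) -rn_sqr -rmorphM/= lecR.
by rewrite mulr_ge0 ?sqr_ge0.
Qed.

End Orthonormal.

(** * Adjoints, absolute values, positive and negative parts *)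

Section Eigenvalues.
Context {R : realType} {H : completeNormedModType R[i]}.
Variable dot : {dot H for Num.conj}.
Hypothesis norm_dot : forall x : H, `|x| ^+ 2 = dot x x.
Local Notation "''[' u , v ]" := (dot u%R v%R) : ring_scope.

Lemma adjointE A B : (forall x y, '[A x, y] = '[x, B y]) -> adjoint dot A = B.
Proof.
move=> AB; apply: get_unique => [//|B' AB']; apply/funext => y.
apply: (dot_inj norm_dot) => x.
by rewrite [LHS](dotC dot) -AB' AB -(dotC dot).
Qed.

(** Without an adjoint, the choice operator returns its default, a constant
    function.  For a self-adjoint or unitary operator a constant function can
    arise only on trivial grounds, where the adjoint relation holds as well. *)
Lemma adjoint_cst A : (forall x y, '[A x, y] = '[x, adjoint dot A y]) \/
  adjoint dot A = (fun=> point).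
Proof.
have [ex|nex] := pselect (exists B, forall x y, '[A x, y] = '[x, B y]).
  by left; exact: (getPex ex).
by right; apply: getPN => B AB; apply: nex; exists B.
Qed.

Lemma selfadjoint_symmetric A : linear A -> selfadjoint dot A -> symmetric_op dot A.
Proof.
move=> Al As; have [] := adjoint_cst A; rewrite As => // Ac.
have A0 : A 0 = 0 by have := Al (-1) 0 0; rewrite scaler0 addr0 scaleN1r addNr.
have A0' x : A x = 0 by rewrite -A0 Ac.
by move=> x y; rewrite !A0' dot0l dot0r.
Qed.

Lemma unitary_adjoint U : unitary dot U -> forall x y, '[U x, y] = '[x, adjoint dot U y].
Proof.
(* A unitary with constant inverse forces the space to be zero. *)
case=> _ _ U1 U2; have [//|Uc] := adjoint_cst U.
have cst0 (x y : H) : x = y.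
  by rewrite -[x]/(id x) -[y]/(id y) -U1 /= Uc.
by move=> x y; rewrite (cst0 (U x) 0) (cst0 x 0) !dot0l.
Qed.

(** Polarization: the quadratic form is real on [x + y] and on [x + i y]. *)
Lemma positive_symmetric A : positive_semidefinite dot A -> symmetric_op dot A.
Proof.
move=> [Al _ A0].
have Ad x y : A (x + y) = A x + A y by rewrite -[x]scale1r Al !scale1r.
have Az a x : A (a *: x) = a *: A x.
  have A00 : A 0 = 0 by have := Al (-1) 0 0; rewrite scaler0 addr0 scaleN1r addNr.
  by rewrite -[a *: x]addr0 Al A00 addr0.
have real x : Num.conj '[A x, x] = '[A x, x].
  by apply/CrealP; rewrite ger0_real.
move=> x y; rewrite (dotC dot x).
have := real (x + y); have := real (x + 'i%C *: y); move: (real x) (real y).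
rewrite !Ad !Az !dotDl !dotDr !dotZl !dotZr.
move: '[A x, x] '[A x, y] '[A y, x] '[A y, y] => [a a'] [p p'] [q q'] [b b'].
move=> [ea] [eb] [e1] [e2]; apply/eqP; rewrite eq_complex/=.
apply/andP; split; apply/eqP; lra.
Qed.

(** Existence of the square root comes from the diagonal operator with entries
    [|a i|].  Conversely, let [B] be any positive square root of [A A]: with
    [y = B f - |a| f] one has [(B + |a|) y = 0], and positivity of both summands
    of [<(B + |a|) y, y>] forces [y = 0]; if [a = 0], then [|B f|^2 = <B B f, f>]
    vanishes. *)
Lemma abs_op_diagonal A a f (M : R) : orthonormal_seq dot f -> diagonal dot A a f ->
  adjoint dot A = A -> (forall i, `|a i| <= M) ->
  diagonal dot (abs_op dot A) (fun i => `|a i|) f.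
Proof.
move=> of_ Ad As aM.
have [] := @getPex _ 
  [set B : H -> H | positive_semidefinite dot B /\ B \o B = adjoint dot A \o A].
  have [|B [Bd Bl Bc]] := @diagonal_exists _ _ _ norm_dot (fun i => `|a i|) M _ of_.
    by move=> i; rewrite normr_id.
  exists B; split; first by split=> //; exact: (diagonal_positive norm_dot of_ Bd).
  rewrite As; apply: (diagonal_inj norm_dot of_ (a := fun i => a i * a i)).
    have -> : (fun i => a i * a i) = (fun i => `|a i| * `|a i|).
      by apply/funext => i; rewrite -normrM ger0_norm// -expr2 sqr_ge0.
    exact: diagonal_comp.
  exact: diagonal_comp.
rewrite -/(abs_op dot A); set B := abs_op dot A; move=> Bp; rewrite As => BB.
have [_ _ B0] := Bp; have Bs := positive_symmetric Bp.
have [Asy Af A0] := Ad.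
have BBe x : B (B x) = A (A x) by have := congr1 (@^~ x) BB.
split=> // [i|x px].
  have [ai0|ai0] := eqVneq (a i) 0.
    rewrite ai0 normr0 scale0r; apply: (dot_eq0 norm_dot).
    by rewrite -Bs BBe Af ai0 scale0r (sym_0 norm_dot)// dot0l.
  pose y := B (f i) - (`|a i|)%:C *: f i.
  have hy : B y + (`|a i|)%:C *: y = 0.
    rewrite /y (sym_sub norm_dot Bs) (sym_scale norm_dot Bs) BBe Af (sym_scale norm_dot Asy) Af.
    rewrite scalerBr !scalerA -!rmorphM -normrM ger0_norm -?expr2 ?sqr_ge0//.
    by rewrite addrA subrK subrr.
  apply/subr0_eq/(dot_eq0 norm_dot)/eqP; rewrite -/y.
  have : '[B y, y] + (`|a i|)%:C * '[y, y] = 0 by rewrite -dotZl -dotDl hy dot0l.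
  have h : 0 <= (`|a i|)%:C * '[y, y].
    by rewrite (dotxx norm_dot) -rmorphM lecR mulr_ge0 ?sqr_ge0.
  move/eqP; rewrite (paddr_eq0 (B0 y) h).
  move=> /andP[_]; rewrite mulf_eq0 => /orP[|]; last by [].
  by rewrite -(rmorph0 (real_complex R)) (inj_eq (@complexI R)) normr_eq0 (negPf ai0).
apply: (dot_eq0 norm_dot); by rewrite -Bs BBe (A0 _ px) (sym_0 norm_dot Asy) dot0l.
Qed.

(** [posp a] and [negp a] are the positive and negative parts of [a], in the form
    which the functional calculus [(|A| + A)/2], [(|A| - A)/2] produces. *)
Definition posp (a : nat -> R) i := (`|a i| + a i) / 2.
Definition negp (a : nat -> R) i := (`|a i| - a i) / 2.

Lemma posp_ge0 a i : 0 <= posp a i.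
Proof. by rewrite /posp; have := ler_norm (- a i); rewrite normrN; lra. Qed.

Lemma negp_ge0 a i : 0 <= negp a i.
Proof. by rewrite /negp; have := ler_norm (a i); lra. Qed.

Lemma posp_le a i : posp a i <= `|a i|.
Proof. by rewrite /posp; have := ler_norm (a i); lra. Qed.

Lemma negp_le a i : negp a i <= `|a i|.
Proof. by rewrite /negp; have := ler_norm (- a i); rewrite normrN; lra. Qed.

Lemma pospN a : posp (fun i => - a i) = negp a.
Proof. by apply/funext => i; rewrite /posp normrN. Qed.

Lemma negpN a : negp (fun i => - a i) = posp a.
Proof. by apply/funext => i; rewrite /negp normrN opprK. Qed.

Lemma pos_part_diagonal A a f (M : R) : orthonormal_seq dot f -> diagonal dot A a f ->
  adjoint dot A = A -> (forall i, `|a i| <= M) ->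
  diagonal dot (pos_part dot A) (posp a) f.
Proof.
move=> of_ Ad As aM; have Bd := abs_op_diagonal of_ Ad As aM.
have := diagonal_comb 2^-1 2^-1 Bd Ad; congr diagonal; apply/funext => x.
  by rewrite /pos_part scalerDr fmorphV rmorph_nat.
by rewrite /posp; ring.
Qed.

Lemma neg_part_diagonal A a f (M : R) : orthonormal_seq dot f -> diagonal dot A a f ->
  adjoint dot A = A -> (forall i, `|a i| <= M) ->
  diagonal dot (neg_part dot A) (negp a) f.
Proof.
move=> of_ Ad As aM; have Bd := abs_op_diagonal of_ Ad As aM.
have := diagonal_comb 2^-1 (- 2^-1) Bd Ad; congr diagonal; apply/funext => x.
  have h : (2^-1 : R)%:C = 2^-1 :> R[i] by rewrite fmorphV rmorph_nat.
  have h' : (- 2^-1 : R)%:C = - 2^-1 :> R[i] by rewrite -h rmorphN.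
  by rewrite /neg_part scalerBr h h' scaleNr.
by rewrite /negp; ring.
Qed.

End Eigenvalues.

(** * Greedy choices and decreasing rearrangements *)

Section Greedy.

(** Dependent choice where each new element may depend on all previous ones; [Q]
    is the invariant of the prefixes and [P] the property of the next element. *)
Lemma greedy_seq (T : Type) (Q : seq T -> Prop) (P : seq T -> T -> Prop) :
  Q [::] -> (forall s, Q s -> exists x, P s x /\ Q (rcons s x)) ->
  exists g : nat -> T, forall n, Q (mkseq g n) /\ P (mkseq g n) (g n).
Proof.
move=> Q0 QP; have [x0 _] := QP _ Q0.
have step s : {x | Q s -> P s x /\ Q (rcons s x)}.
  apply: cid; have [Qs|nQ] := pselect (Q s); last by exists x0.
  by have [x hx] := QP s Qs; exists x.
pose hist := fix hist n := if n is m.+1 then rcons (hist m) (sval (step (hist m))) else [::].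
pose g n := sval (step (hist n)).
have hE n : hist n = mkseq g n.
  by elim: n => // n IH; rewrite mkseqS -IH.
have Qh n : Q (hist n).
  by elim: n => [//|n IH] /=; have [] := svalP (step (hist n)) IH.
exists g => n; rewrite -hE; split => //.
by have [] := svalP (step (hist n)) (Qh n).
Qed.

Lemma injective_unbounded (s : nat -> nat) : injective s ->
  forall N, exists2 n, (n <= N)%N & (N <= s n)%N.
Proof.
move=> sI N; apply/not_exists2P => h.
have : (size (mkseq s N.+1) <= size (iota 0 N))%N.
  apply: uniq_leq_size; first by apply/mkseq_uniqP => i j _ _ /sI.
  move=> x /mapP[n]; rewrite mem_iota add0n ltnS /= => nN ->; rewrite mem_iota/= add0n.
  by have [//|/negP] := h n; rewrite -ltnNge.
by rewrite size_mkseq size_iota ltnn.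
Qed.

End Greedy.

Section Rearrangement.
Context {R : realType}.

Definition vanishing (a : nat -> R) :=
  forall e, 0 < e -> exists N, forall n, (N <= n)%N -> `|a n| < e.

Lemma vanishing_le (a b : nat -> R) : (forall i, `|a i| <= `|b i|) ->
  vanishing b -> vanishing a.
Proof.
by move=> ab b0 e /b0[N hN]; exists N => n /hN; exact: le_lt_trans.
Qed.

Lemma vanishing_bounded (a : nat -> R) : vanishing a -> exists M : R, forall i, `|a i| <= M.
Proof.
move=> /(_ 1 ltr01)[N hN]; exists (\sum_(i < N) `|a i| + 1) => i.
case: (leqP N i) => iN; first by rewrite (le_trans (ltW (hN _ iN)))// lerDr sumr_ge0.
by rewrite (bigD1 (Ordinal iN))//= -addrA lerDl addr_ge0// sumr_ge0.
Qed.

(** Above any positive value of [a] there are only finitely many others; if no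
    positive value is left, any index outside [s] will do. *)
Lemma argmax_outside (a : nat -> R) (s : seq nat) :
  (forall i, 0 <= a i) -> vanishing a ->
  exists i, i \notin s /\ forall j, j \notin s -> a j <= a i.
Proof.
move=> a0 av.
have [[j1 [j1s aj1]]|none] := pselect (exists j, j \notin s /\ 0 < a j).
  have [N hN] := av _ aj1.
  have j1N : (j1 < N)%N.
    by rewrite ltnNge; apply/negP => /hN; rewrite ger0_norm// ltxx.
  have := @arg_maxP _ R _ (Ordinal j1N) (fun i : 'I_N => val i \notin s) (fun i => a i) j1s.
  case=> i is_ imax; exists (val i); split=> // j js.
  have [jN|/hN] := ltnP j N; first exact: (imax (Ordinal jN)).
  rewrite ger0_norm// => /ltW /le_trans; apply; exact: (imax (Ordinal j1N)).
have [n nN hn] := injective_unbounded (@inj_id nat) (\max_(i <- s) i).+1.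
exists n; split; last first.
  move=> j js; apply: le_trans (a0 n); rewrite leNgt; apply/negP => aj; apply: none.
  by exists j.
apply/negP => ns; move: hn; rewrite ltnNge => /negP; apply.
exact: (leq_bigmax_seq (F := id) n ns).
Qed.

(** Pick a maximal remaining entry forever.  An entry never picked lies below all
    the picked ones, which tend to zero.  If only finitely many entries are
    positive, the list goes on with zero entries, matching the convention that
    eigenvalue sequences are filled up with zeros. *)
Lemma decreasing_rearrangement (a : nat -> R) :
  (forall i, 0 <= a i) -> vanishing a ->
  exists s : nat -> nat, [/\ injective s, nonincreasing_seq (a \o s) &
    forall i, 0 < a i -> exists k, s k = i].
Proof.
move=> a0 av.
have [|s'|s hs] := @greedy_seq nat (fun=> True)
  (fun s i => i \notin s /\ forall j, j \notin s -> a j <= a i) => //.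
  by have [i hi] := argmax_outside s' a0 av; exists i.
have notin i j : (j < i)%N -> s i <> s j.
  move=> ij sij; have [_ [+ _]] := hs i; rewrite sij => /negP; apply.
  by apply/mapP; exists j => //; rewrite mem_iota.
have sI : injective s.
  move=> i j sij; apply: contrapT => /eqP; rewrite neq_ltn => /orP[] /notin; last exact.
  by apply.
have smono n m : (n <= m)%N -> a (s m) <= a (s n).
  move=> nm; have [_ [_ ]] := hs n; apply; apply/negP => /mapP[k].
  rewrite mem_iota/= add0n => kn /sI mk; move: kn; rewrite -mk ltnNge nm//.
exists s; split=> //.
move=> i ai; apply: contrapT => nex.
have [N hN] := av _ ai; have [n _ /hN] := injective_unbounded sI N.
rewrite ger0_norm// ltNge => /negP; apply; have [_ [_]] := hs n; apply.
by apply/negP => /mapP[k _ ik]; apply: nex; exists k.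
Qed.

End Rearrangement.

(** * Eigenvalue sequences *)

Section HasDim.
Context {R : realType} {H : lmodType R[i]}.

(** A matrix with more rows than columns has a nonzero left kernel, which would
    be a linear relation between the elements of the longer basis. *)
Lemma has_dim_le (V : set H) n m : has_dim V n -> has_dim V m -> (n <= m)%N.
Proof.
move=> [b [bfree Vb]] [b' [_ Vb']]; rewrite leqNgt; apply/negP => mn.
have bV i : exists c : 'I_m -> R[i], b i = \sum_(j < m) c j *: b' j.
  suff : V (b i) by rewrite Vb'.
  rewrite Vb /=; exists (fun j => (j == i)%:R).
  rewrite (bigD1 i)//= eqxx scale1r big1 ?addr0// => j /negPf ->.
  by rewrite scale0r.
have [c hc] := choice bV.
pose M := \matrix_(i < n, j < m) c i j.
have : kermx M != 0.
  rewrite -mxrank_eq0 mxrank_ker subn_eq0 -ltnNge.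
  by apply: leq_ltn_trans mn; exact: rank_leq_col.
move/rowV0Pn => [v /sub_kermxP vM] /eqP; apply; apply/rowP => i; rewrite mxE.
apply: bfree; under eq_bigr do rewrite hc scaler_sumr.
rewrite exchange_big big1//= => j _.
under eq_bigr do rewrite scalerA.
rewrite -scaler_suml; move/rowP/(_ j): vM; rewrite !mxE.
by under eq_bigr do rewrite mxE; move=> ->; rewrite scale0r.
Qed.

Lemma has_dim_inj (V : set H) n m : has_dim V n -> has_dim V m -> n = m.
Proof. by move=> Vn Vm; apply/eqP; rewrite eqn_leq !(has_dim_le Vn Vm, has_dim_le Vm Vn). Qed.

(** At the first index where the sequences differ, the larger value would have a
    larger multiplicity in one sequence than in the other, whereas both
    multiplicities equal the dimension of its eigenspace. *)
Lemma eigenvalue_seq_le (A : H -> H) (l l' : nat -> R) :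
  is_eigenvalue_seq A l -> is_eigenvalue_seq A l' ->
  forall n, (forall k, (k < n)%N -> l k = l' k) -> l n <= l' n.
Proof.
move=> [lm l0 lA] [lm' l0' lA'] n eqn; rewrite leNgt; apply/negP => h.
have mu0 : 0 < l n by apply: le_lt_trans h.
have [d Vd Sd] := lA _ mu0; have [d' Vd' Sd'] := lA' _ mu0.
rewrite -(has_dim_inj Vd Vd') in Sd' => {d' Vd'}.
set S := [set j | l j = l n] in Sd; set S' := [set j | l' j = l n] in Sd'.
have fS : finite_set S by exists d.
have fS' : finite_set S' by exists d.
have S'n k : S' k -> (k < n)%N.
  move=> S'k; rewrite ltnNge; apply/negP => nk.
  by have := lm' _ _ nk; rewrite S'k leNgt h.
have S'S : S' `<=` S by move=> k S'k; rewrite /S/= eqn ?S'n.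
have : fset_set S' == fset_set S.
  rewrite eqEfcard; apply/andP; split; first by rewrite -fset_set_sub.
  by rewrite (card_fset_set Sd) (card_fset_set Sd').
move/eqP/fsetP/(_ n); rewrite !in_fset_set//.
have -> : (n \in S') = false by apply/negbTE/negP => /set_mem/S'n; rewrite ltnn.
by move/esym/negP; apply; exact: mem_set.
Qed.

Lemma is_eigenvalue_seq_unique (A : H -> H) (l l' : nat -> R) :
  is_eigenvalue_seq A l -> is_eigenvalue_seq A l' -> l = l'.
Proof.
move=> hl hl'; apply/funext => n; elim/ltn_ind: n => n IH.
apply/eqP; rewrite eq_le (eigenvalue_seq_le hl hl')//=.
by apply: (eigenvalue_seq_le hl' hl) => k /IH.
Qed.

End HasDim.

Section EigenvalueSeq.
Context {R : realType} {H : completeNormedModType R[i]}.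
Variable dot : {dot H for Num.conj}.
Hypothesis norm_dot : forall x : H, `|x| ^+ 2 = dot x x.
Local Notation "''[' u , v ]" := (dot u%R v%R) : ring_scope.

Lemma orthonormal_reindex f (s : nat -> nat) : orthonormal_seq dot f -> injective s ->
  orthonormal_seq dot (f \o s).
Proof. by move=> of_ sI i j /=; rewrite of_ (inj_eq sI). Qed.

(** A vector orthogonal to the eigenvectors with nonzero eigenvalue is already in
    the kernel. *)
Lemma diagonal_reindex A a f (s : nat -> nat) : orthonormal_seq dot f -> diagonal dot A a f ->
  (forall i, a i != 0 -> exists k, s k = i) -> diagonal dot A (a \o s) (f \o s).
Proof.
move=> of_ Ad sa; have [As Af A0] := Ad; split=> // [i|x px]; first exact: Af.
apply: (dot_inj norm_dot) => y; rewrite dot0l.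
apply: (tends_unique (diagonal_expansion norm_dot of_ Ad x y)) => e e0.
exists 0%N => n _; rewrite big1 ?subrr ?rn0// => i _.
have [->|/sa[k ik]] := eqVneq (a i) 0; first by rewrite !mul0r.
by rewrite -ik px mulr0 mul0r.
Qed.

(** Since [a] tends to zero, finitely many indices carry the eigenvalue [mu].  An
    eigenvector for [mu] minus its components along them is orthogonal to all of
    [f]; it lies in the kernel and in the eigenspace, hence is zero. *)
Lemma diagonal_eigenspace A a f (mu : R) : orthonormal_seq dot f -> diagonal dot A a f ->
  vanishing a -> 0 < mu -> exists2 n,
    has_dim (eigenspace A mu) n & ([set j | a j = mu] #= `I_n)%card.
Proof.
move=> of_ [As Af A0] av mu0; have [N hN] := av _ mu0.
pose s := [seq j <- iota 0 N | a j == mu].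
have us : uniq s by rewrite filter_uniq// iota_uniq.
have sP j : (j \in s) = (a j == mu).
  rewrite mem_filter mem_iota/= add0n; case: eqVneq => //= aj.
  rewrite ltnNge; apply/negP => /hN; rewrite aj ger0_norm ?ltxx// ltW//.
exists (size s); last first.
  have -> : [set j | a j = mu] = [set` [fset x in s]%fset].
    apply/seteqP; split => j /=; rewrite !inE sP; first by move=> ->.
    by move/eqP.
  apply/card_eq_fsetP.
  by rewrite card_fseq undup_id.
pose b (i : 'I_(size s)) := f (nth 0%N s i).
have ob i j : '[b i, b j] = (i == j)%:R by rewrite of_ nth_uniq.
have dotb (c : 'I_(size s) -> R[i]) j : '[\sum_i c i *: b i, b j] = c j.
  rewrite dot_suml (bigD1 j)//= dotZl ob eqxx mulr1 big1 ?addr0// => i /negPf ij.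
  by rewrite dotZl ob ij mulr0.
exists b; split; first by move=> c c0 i; rewrite -(dotb c i) c0 dot0l.
apply/seteqP; split => x /=; rewrite /eigenspace/=; last first.
  move=> [c ->]; rewrite (big_morph A (sym_add norm_dot As) (sym_0 norm_dot As)).
  rewrite scaler_sumr; apply: eq_bigr => i _; rewrite (sym_scale norm_dot As) Af.
  have : nth 0%N s i \in s by rewrite mem_nth.
  by rewrite sP => /eqP ->; rewrite !scalerA mulrC.
move=> Ax; exists (fun i => '[x, b i]).
set y := \sum_i _; pose z := x - y.
have pz : perp dot f z.
  move=> k; rewrite /z dotBl; have [ks|ks] := boolP (k \in s).
    have ki : (index k s < size s)%N by rewrite index_mem.
    have -> : f k = b (Ordinal ki) by rewrite /b /= nth_index.
    by rewrite dotb subrr.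
  have -> : '[y, f k] = 0.
    rewrite dot_suml big1// => i _; rewrite dotZl of_.
    suff /negPf -> : nth 0%N s i != k by rewrite mulr0.
    by apply: contraNneq ks => <-; rewrite mem_nth.
  have : mu%:C * '[x, f k] = (a k)%:C * '[x, f k].
    by rewrite -dotZl -Ax As Af dotZr conjR.
  move/eqP; rewrite -subr_eq0 -mulrBl mulf_eq0 subr_eq0 (inj_eq (@complexI R)).
  by rewrite eq_sym -sP (negPf ks)/= => /eqP ->; rewrite subr0.
have : A z = mu%:C *: z.
  rewrite /z (sym_sub norm_dot As) Ax scalerBr; congr (_ - _).
  rewrite (big_morph A (sym_add norm_dot As) (sym_0 norm_dot As)).
  rewrite scaler_sumr; apply: eq_bigr => i _; rewrite (sym_scale norm_dot As) Af.
  have : nth 0%N s i \in s by rewrite mem_nth.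
  by rewrite sP => /eqP ->; rewrite !scalerA mulrC.
rewrite A0// => /esym/eqP; rewrite scaler_eq0 -(rmorph0 (real_complex R)).
rewrite (inj_eq (@complexI R)) (gt_eqF mu0)/= => /eqP z0.
by apply/subr0_eq.
Qed.

Lemma eigenvalue_seqE A a f : orthonormal_seq dot f -> diagonal dot A a f ->
  vanishing a -> (forall i, 0 <= a i) -> nonincreasing_seq a -> eigenvalue_seq A = a.
Proof.
move=> of_ Ad av a0 am.
have h : is_eigenvalue_seq A a.
  by split=> // mu mu0; exact: (diagonal_eigenspace of_ Ad).
by apply: get_unique => [//|l hl]; exact: is_eigenvalue_seq_unique hl h.
Qed.

(** Reindexing the eigenvectors along with the sorted diagonal reduces to
    [eigenvalue_seqE]. *)
Lemma eigenvalue_seq_rearrangement A a f : orthonormal_seq dot f -> diagonal dot A a f ->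
  vanishing a -> (forall i, 0 <= a i) ->
  exists s : nat -> nat, [/\ injective s, eigenvalue_seq A = a \o s,
    nonincreasing_seq (a \o s) & forall i, 0 < a i -> exists k, s k = i].
Proof.
move=> of_ Ad av a0; have [s [sI sm sa]] := decreasing_rearrangement a0 av.
exists s; split=> //; apply: (eigenvalue_seqE (orthonormal_reindex of_ sI)) => //.
- apply: (diagonal_reindex of_ Ad) => i ai; apply: sa.
  by rewrite lt_neqAle eq_sym ai a0.
- move=> e e0; have [N hN] := av _ e0; have [n _ /hN] := injective_unbounded sI N.
  move=> h; exists n => m nm; apply: le_lt_trans h; rewrite !ger0_norm//=.
  exact: sm.
- by move=> i /=; exact: a0.
Qed.

End EigenvalueSeq.

(** * The spectral theorem and orthonormal bases *)

Section Compact.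
Context {R : realType} {H : completeNormedModType R[i]}.
Variable dot : {dot H for Num.conj}.
Hypothesis norm_dot : forall x : H, `|x| ^+ 2 = dot x x.
Local Notation "''[' u , v ]" := (dot u%R v%R) : ring_scope.

Lemma compact_op_cluster (A : H -> H) (x : nat -> H) :
  compact_op A -> (forall n, rn (x n) <= 1) ->
  exists y, forall e : R, 0 < e -> forall N, exists2 n, (N <= n)%N & rn (A (x n) - y) < e.
Proof.
move=> [_]; rewrite precompactE => cA x1.
have [|y [_ cy]] := cA ((A \o x) @ \oo) _.
  exists 0%N => // n _; apply: subset_closure; exists (x n) => //=.
  by rewrite -rnE -(rmorph1 (real_complex R)) lecR.
exists y => e e0 N.
have h1 : ((A \o x) @ \oo) [set A (x n) | n in [set n | (N <= n)%N]].
  by exists N => // n Nn; exists n.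
have h2 : nbhs y (ball y e%:C) by apply: nbhsx_ballx; rewrite ltcR.
have [_ [/= [n Nn <-] hn]] := cy _ _ h1 h2.
by exists n => //; move: hn; rewrite -ball_normE/= -rnE ltcR rnBC.
Qed.

Definition normalize (x : H) : H := ((rn x)^-1)%:C *: x.

Lemma rn_normalize x : x != 0 -> rn (normalize x) = 1.
Proof.
move=> x0; rewrite /normalize rnZ rnR ger0_norm ?invr_ge0 ?rn_ge0// mulVf//.
by rewrite rn_eq0.
Qed.

Lemma normalizeK x : x != 0 -> x = (rn x)%:C *: normalize x.
Proof.
by move=> x0; rewrite scalerA -rmorphM/= mulfV ?rn_eq0// rmorph1 scale1r.
Qed.

(** Let [M] be the norm of [A] on the closed invariant subspace [V], and let [y]
    be a cluster point of [A x] along a maximizing sequence of [x] in the unit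
    ball of [V].  Then [|y| = M], and [|A y| = M^2] because [<A y, x> = <y, A x>]
    is close to [|y|^2].  Expanding the square,
    [|A A y - M^2 y|^2 <= M^6 - 2 M^2 M^4 + M^6 = 0].  So [(A - M) (A + M) y = 0],
    which makes either [y] or [(A + M) y] an eigenvector, for [-M] or [M]. *)
Lemma top_eigenvector (A : H -> H) (V : set H) :
  compact_op A -> symmetric_op dot A ->
  (forall x y, V x -> V y -> V (x + y)) -> (forall a x, V x -> V (a *: x)) ->
  (forall y, (forall e : R, 0 < e -> exists2 x, V x & rn (x - y) < e) -> V y) ->
  (forall x, V x -> V (A x)) -> (exists2 x, V x & x != 0) ->
  exists v (c : R), [/\ V v, rn v = 1, A v = c%:C *: v &
    forall x, V x -> rn (A x) <= `|c| * rn x].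
Proof.
move=> Ac As VD VZ Vcl VA [x0 Vx0 x0n].
have V0 : V 0 by rewrite -(scale0r x0); exact: VZ.
have A0 := sym_0 norm_dot As.
pose S := [set r : R | exists x, [/\ V x, rn x <= 1 & r = rn (A x)]].
have hS : has_sup S.
  split; first by exists 0, 0; split=> //; rewrite ?A0 ?rn0.
  apply: contrapT => nub.
  have ex n : exists x, [/\ V x, rn x <= 1 & n%:R < rn (A x)].
    apply: contrapT => nex; apply: nub; exists n%:R => _ [x [Vx x1 ->]].
    by rewrite leNgt; apply/negP => h; apply: nex; exists x.
  have [x hx] := choice ex.
  have [|y hy] := @compact_op_cluster A x Ac; first by move=> n; have [] := hx n.
  have [n] := hy 1 ltr01 (Num.truncn (rn y + 1)).+1.
  move=> nN; have [_ _ hn] := hx n => h.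
  have : rn y + 1 < n%:R.
    by apply: lt_le_trans (truncnS_gt _) _; rewrite ler_nat.
  have := rnD (A (x n) - y) y; rewrite subrK; lra.
set M := sup S.
have M0 : 0 <= M by apply: sup_upper_bound => //; exists 0; split=> //; rewrite ?A0 ?rn0.
have AM x : V x -> rn (A x) <= M * rn x.
  move=> Vx; have [->|xn] := eqVneq x 0; first by rewrite A0 rn0 mulr0.
  rewrite {1}(normalizeK xn) (sym_scale norm_dot As) rnZ rnR ger0_norm ?rn_ge0// mulrC.
  rewrite ler_wpM2r ?rn_ge0//; apply: sup_upper_bound => //.
  by exists (normalize x); split=> //; [exact: VZ|rewrite rn_normalize].
have [M00|Mn0] := eqVneq M 0.
  exists (normalize x0), 0; split; [exact: VZ|exact: rn_normalize| |].
    apply/eqP; rewrite scale0r -rn_eq0 eq_le rn_ge0 andbT.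
    by rewrite -(mul0r (rn (normalize x0))) -M00; apply: AM; exact: VZ.
  by move=> x Vx; rewrite normr0 -M00; exact: AM.
have Mp : 0 < M by rewrite lt_neqAle eq_sym Mn0.
have ex n : exists x, [/\ V x, rn x <= 1 & M - n.+1%:R^-1 < rn (A x)].
  have [_ [x [Vx x1 ->]] h] := @sup_adherent _ S n.+1%:R^-1 (ltac:(by rewrite invr_gt0)) hS.
  by exists x.
have [x hx] := choice ex.
have [|y hy] := @compact_op_cluster A x Ac; first by move=> n; have [] := hx n.
have Vy : V y.
  apply: Vcl => e /hy/(_ 0%N)[n _ h]; exists (A (x n)) => //.
  by apply: VA; have [] := hx n.
have xM n : rn (A (x n)) <= M.
  have [Vx x1 _] := hx n; apply: le_trans (AM _ Vx) _.
  by rewrite -[leRHS]mulr1 ler_wpM2l.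
have yM : rn y = M.
  apply/eqP; rewrite eq_le; apply/andP; split; apply/ler_addgt0Pr => e e0.
    have [n _ h] := hy _ e0 0%N; have := xM n.
    have := rnD (y - A (x n)) (A (x n)); rewrite subrK rnBC; lra.
  have e2 : 0 < e / 2 by rewrite divr_gt0.
  have [n nN h] := hy _ e2 (Num.truncn (e / 2)^-1).
  (* The index n exceeds 2 / e, so that the deficit 1 / (n + 1) is below e / 2. *)
  have [_ _ hn] := hx n; move: hn; set u := n.+1%:R^-1 => hn.
  have : u < e / 2.
    rewrite -[e / 2]invrK ltf_pV2 ?posrE ?invr_gt0//.
    by apply: lt_le_trans (truncnS_gt _) _; rewrite ler_nat.
  have := rnD (A (x n) - y) y; rewrite subrK; lra.
have Ay1 : rn (A y) <= M ^+ 2 by rewrite expr2 -{2}yM; exact: AM.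
have Ay2 : M ^+ 2 <= rn (A y).
  apply/ler_addgt0Pr => e e0; have eM : 0 < e / M by rewrite divr_gt0.
  have [n _ h] := hy _ eM 0%N; have [_ x1 _] := hx n.
  have h1 : rn '[A y, x n] <= rn (A y).
    apply: le_trans (CauchySchwarz norm_dot _ _) _.
    by rewrite -[leRHS]mulr1 ler_wpM2l ?rn_ge0.
  have h2 : rn '[y, y - A (x n)] <= e.
    apply: le_trans (CauchySchwarz norm_dot _ _) _.
    by rewrite yM rnBC mulrC -ler_pdivlMr// ltW.
  have := rnD '[y, y - A (x n)] '[A y, x n].
  rewrite As -dotDr subrK (dotxx norm_dot) rnR ger0_norm ?sqr_ge0// yM -As; lra.
have AAy : A (A y) = (M ^+ 2)%:C *: y.
  apply/subr0_eq/eqP; rewrite -rn_eq0 -sqrf_eq0 eq_le sqr_ge0 andbT.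
  rewrite (rnD_sqr norm_dot) dotNr dotZr conjR rnN rnZ rnR As (dotxx norm_dot).
  have rAy : rn (A y) = M ^+ 2 by apply/eqP; rewrite eq_le Ay1 Ay2.
  have := AM _ (VA _ Vy); rewrite rAy yM -rmorphM -rmorphN/= ger0_norm ?sqr_ge0// => h.
  have h2 : rn (A (A y)) ^+ 2 <= (M * M ^+ 2) ^+ 2.
    by rewrite ler_sqr ?nnegrE ?rn_ge0// mulr_ge0// sqr_ge0.
  apply: le_trans
    (_ : (M * M ^+ 2) ^+ 2 + (M ^+ 2 * M) ^+ 2 + 2 * - (M ^+ 2 * (M ^+ 2) ^+ 2) <= 0).
    by rewrite -addrA -[leRHS]addrA lerD2r.
  by rewrite le_eqVlt; apply/orP; left; apply/eqP; ring.
pose w := A y + M%:C *: y.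
have yn0 : y != 0 by rewrite -rn_eq0 yM.
have [w0|wn0] := eqVneq w 0.
  exists (normalize y), (- M); split; [exact: VZ|exact: rn_normalize| |].
    rewrite (sym_scale norm_dot As) scalerA mulrC -scalerA; congr (_ *: _).
    by apply/eqP; rewrite rmorphN scaleNr -subr_eq0 opprK -/w w0.
  by move=> z Vz; rewrite normrN ger0_norm//; exact: AM.
exists (normalize w), M; split; last 2 first.
- rewrite (sym_scale norm_dot As) scalerA mulrC -scalerA; congr (_ *: _).
  rewrite /w (sym_add norm_dot As) AAy (sym_scale norm_dot As) scalerDr scalerA.
  by rewrite -rmorphM addrC.
- by move=> z Vz; rewrite ger0_norm//; exact: AM.
- by apply: (VZ); apply: VD; [exact: VA|exact: VZ].
- exact: rn_normalize.
Qed.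

Definition orthonormal_list (s : seq H) := forall i j, (i < size s)%N -> (j < size s)%N ->
  '[nth 0 s i, nth 0 s j] = (i == j)%:R.

Definition perp_list (s : seq H) : set H := [set x | forall v, v \in s -> '[x, v] = 0].

Lemma orthonormal_list_rcons s v : orthonormal_list s -> perp_list s v -> rn v = 1 ->
  orthonormal_list (rcons s v).
Proof.
move=> os pv v1 i j; rewrite size_rcons !ltnS !nth_rcons => hi hj.
have vv : '[v, v] = 1 by rewrite (dotxx norm_dot) v1 expr1n rmorph1.
have [ei|il] := eqVneq i (size s); have [ej|jl] := eqVneq j (size s).
- by rewrite ei ej ltnn/= eqxx.
- have jl' : (j < size s)%N by rewrite ltn_neqAle jl.
  by rewrite ei ltnn jl' pv ?mem_nth// eq_sym (negPf jl).
- have il' : (i < size s)%N by rewrite ltn_neqAle il.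
  rewrite ej ltnn il' (negPf il) (dotC dot) pv ?mem_nth//; exact: conjC0.
- have il' : (i < size s)%N by rewrite ltn_neqAle il.
  have jl' : (j < size s)%N by rewrite ltn_neqAle jl.
  by rewrite il' jl'; exact: os.
Qed.

(** One step of the Gram-Schmidt process. *)
Lemma residual_perp s x : orthonormal_list s ->
  perp_list s (x - \sum_(i < size s) '[x, nth 0 s i] *: nth 0 s i).
Proof.
move=> os v vs; have vi : (index v s < size s)%N by rewrite index_mem.
have vE : nth 0 s (index v s) = v by rewrite nth_index.
have ov i : (i < size s)%N -> '[nth 0 s i, v] = (i == index v s)%:R.
  by move=> il; rewrite -os// vE.
rewrite dotBl dot_suml (bigD1 (Ordinal vi))//= big1 => [|i iv].
  have vv : '[v, v] = 1 by have := ov _ vi; rewrite vE eqxx.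
  by rewrite vE dotZl vv mulr1 addr0 subrr.
rewrite dotZl ov// (_ : (_ == _) = false) ?mulr0//.
by apply: contraNF iv => /eqP e; apply/eqP/val_inj.
Qed.

(** Otherwise the finite list would be a basis of the whole space. *)
Lemma perp_list_unit s : infinite_dimensional H -> orthonormal_list s ->
  exists2 v, perp_list s v & rn v = 1.
Proof.
move=> infH os.
have [[x px x0]|none] := pselect (exists2 x, perp_list s x & x != 0).
  exists (normalize x); last exact: rn_normalize.
  by move=> v vs; rewrite dotZl px ?mulr0.
exfalso; apply: (infH (size s)); exists (fun i => nth 0 s i); split.
  move=> c c0 i; have := congr1 (dot^~ (nth 0 s i)) c0.
  rewrite /= dot0l dot_suml (bigD1 i)//= dotZl os// eqxx mulr1 big1 ?addr0// => j ji.
  by rewrite dotZl os// (_ : (_ == _) = false) ?mulr0//;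
    apply: contraNF ji => /eqP e; apply/eqP/val_inj.
apply/seteqP; split=> // x _; exists (fun i => '[x, nth 0 s i]).
apply/subr0_eq/eqP; apply: contrapT => /negP h; apply: none.
by exists (x - \sum_(i < size s) '[x, nth 0 s i] *: nth 0 s i) => //; exact: residual_perp.
Qed.

(** Split off eigenvectors of maximal eigenvalue one after the other, each in the
    orthogonal complement of the previous ones.  The eigenvalues tend to zero:
    otherwise the vectors [A (f n)] would stay at a fixed distance from each
    other and could not cluster.  The eigenvalue [c n] bounds [A] on the
    complement of the first [n] vectors, so [A] vanishes on the complement of
    them all. *)
Lemma spectral_theorem (A : H -> H) : infinite_dimensional H -> compact_op A ->
  symmetric_op dot A -> exists c f, [/\ orthonormal_seq dot f, diagonal dot A c f,
    vanishing c & nonincreasing_seq (fun i => `|c i|)].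
Proof.
move=> infH Ac As.
pose lam v : R := complex.Re '[A v, v].
have lamE v (c : R) : rn v = 1 -> A v = c%:C *: v -> lam v = c.
  by move=> v1 Av; rewrite /lam Av dotZl (dotxx norm_dot) v1 expr1n mulr1.
pose Q s := orthonormal_list s /\ forall v, v \in s -> A v = (lam v)%:C *: v.
pose P s v := [/\ perp_list s v, rn v = 1, A v = (lam v)%:C *: v &
  forall x, perp_list s x -> rn (A x) <= `|lam v| * rn x].
have [||f hf] := @greedy_seq H Q P.
- by split.
- move=> s [os As'].
  have [|||||v [c [Vv v1 Av Vb]]] := @top_eigenvector A (perp_list s) Ac As.
  + by move=> x y px py v vs; rewrite dotDl px// py// addr0.
  + by move=> a x px v vs; rewrite dotZl px// mulr0.
  + move=> y hy v vs; apply/eqP; rewrite -rn_eq0 eq_le rn_ge0 andbT.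
    apply/ler_addgt0Pr => e e0; rewrite add0r.
    have [|x px h] := hy (e / (rn v + 1)); first by rewrite divr_gt0// ltr_wpDl.
    rewrite -[X in rn X]subr0 -[X in _ - X](px v vs) -dotBl.
    apply: le_trans (CauchySchwarz norm_dot _ _) _; rewrite rnBC.
    move: h; rewrite ltr_pdivlMr ?ltr_wpDl// => /ltW; apply: le_trans.
    by rewrite ler_wpM2l// lerDl.
  + by move=> x px v vs; rewrite As As'// dotZr px ?mulr0.
  + have [v pv v1] := perp_list_unit infH os; exists v => //.
    by rewrite -rn_eq0 v1 oner_eq0.
  have lv := lamE _ _ v1 Av.
  exists v; split; first by split; rewrite ?lv.
  split; first exact: orthonormal_list_rcons.
  by move=> u; rewrite mem_rcons inE => /predU1P[->|/As'//]; rewrite lv.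
have f1 n : rn (f n) = 1 by have [_ []] := hf n.
have fperp m n : (n < m)%N -> '[f m, f n] = 0.
  move=> nm; have [_ [h _ _ _]] := hf m; apply: h.
  by apply/mapP; exists n => //; rewrite mem_iota.
have of_ : orthonormal_seq dot f.
  move=> i j; case: ltngtP => [ij|ji|->]; last by rewrite (dotxx norm_dot) f1 expr1n.
    by rewrite (dotC dot) fperp// conjC0.
  by rewrite fperp.
have Af n : A (f n) = (lam (f n))%:C *: f n by have [_ []] := hf n.
have bnd n x : (forall k, (k < n)%N -> '[x, f k] = 0) -> rn (A x) <= `|lam (f n)| * rn x.
  move=> px; have [_ [_ _ _ h]] := hf n; apply: h => v /mapP[k].
  by rewrite mem_iota => kn ->; exact: px.
have mono : nonincreasing_seq (fun i => `|lam (f i)|).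
  move=> n m nm; have := @bnd n (f m); rewrite Af rnZ rnR f1 !mulr1; apply.
  by move=> k kn; rewrite fperp// (leq_trans kn).
have van : vanishing (fun i => lam (f i)).
  move=> e e0; apply: contrapT => nN.
  have ge n : e <= `|lam (f n)|.
    rewrite leNgt; apply/negP => h; apply: nN; exists n => m nm.
    by apply: le_lt_trans h; exact: mono.
  have [|y hy] := @compact_op_cluster A f Ac; first by move=> n; rewrite f1.
  have e2 : 0 < e / 2 by rewrite divr_gt0.
  have [n _ hn] := hy _ e2 0%N; have [m nm hm] := hy _ e2 n.+1.
  have : rn (A (f m) - A (f n)) < e.
    rewrite -(subrK y (A (f m))) -addrA (splitr e); apply: le_lt_trans (rnD _ _) _.
    by rewrite ltrD// rnBC.
  rewrite -(@ltr_pXn2r _ 2)// ?nnegrE// ?ltW// (pythagoras norm_dot); last first.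
    by rewrite !Af dotNr dotZl dotZr fperp// !mulr0 oppr0.
  rewrite rnN !Af !rnZ !rnR !f1 !mulr1 => h.
  have : e ^+ 2 <= `|lam (f n)| ^+ 2 by rewrite ler_sqr ?nnegrE ?normr_ge0 ?(ltW e0).
  by have := sqr_ge0 `|lam (f m)|; lra.
exists (fun i => lam (f i)), f; split=> //; split=> // x px.
apply/eqP; rewrite -rn_eq0 eq_le rn_ge0 andbT; apply/ler_addgt0Pr => e e0; rewrite add0r.
have x1 : 0 < rn x + 1 by rewrite ltr_wpDl.
have [|N /(_ N (leqnn _))] := van (e / (rn x + 1)); first by rewrite divr_gt0.
rewrite ltr_pdivlMr// => /ltW h; apply: le_trans h.
apply: le_trans (bnd N x _) _ => //.
by rewrite ler_wpM2l// lerDl.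
Qed.

Lemma dense_sequence : separable_space H ->
  exists d : nat -> H, forall x (e : R), 0 < e -> exists n, rn (x - d n) < e.
Proof.
move=> [D /countable_injP[g gI] Dd].
exists (fun n => get [set x | D x /\ g x = n]) => x e e0.
have ne : (ball x e%:C)^° !=set0.
  by exists x; rewrite /interior; apply: nbhsx_ballx; rewrite ltcR.
have [z [xz Dz]] := Dd _ ne (@open_interior _ _).
exists (g z); rewrite /=; set w := get _.
have [Dw gw] : [set y | D y /\ g y = g z] w by apply: getI; split; [exact: Dz|].
have -> : w = z by apply: gI => //; exact: mem_set.
by have := interior_subset xz; rewrite -ball_normE/= -rnE ltcR.
Qed.

(** Gram-Schmidt along a dense sequence [d]: the [n]-th vector is the normalized
    residual of [d n], or any unit vector orthogonal to the previous ones when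
    [d n] already lies in their span.  A basis is what makes the trace of a
    given operator unique. *)
Lemma orthonormal_basis_exists : infinite_dimensional H -> separable_space H ->
  exists e, orthonormal_basis dot e.
Proof.
move=> infH /dense_sequence[d hd].
(* The last clause says that d (size s) lies in the span of s and v. *)
pose P s v := [/\ perp_list s v, rn v = 1 &
  forall x, perp_list (rcons s v) x -> '[x, d (size s)] = 0].
have [||e he] := @greedy_seq H orthonormal_list P.
- by [].
- move=> s os; set n := size s.
  set S := \sum_(i < size s) '[d n, nth 0 s i] *: nth 0 s i.
  have pS x : perp_list s x -> '[x, S] = 0.
    by move=> px; rewrite dot_sumr big1// => i _; rewrite dotZr px ?mulr0// mem_nth.
  have pr := residual_perp (d n) os; rewrite -/S in pr.
  suff [v [pv v1 hv]] : exists v, P s v by exists v; split=> //; exact: orthonormal_list_rcons.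
  have [r0|rn0] := eqVneq (d n - S) 0.
    have [v pv v1] := perp_list_unit infH os; exists v; split=> // x px.
    by rewrite (subr0_eq r0) pS// => u us; apply: px; rewrite mem_rcons inE us orbT.
  exists (normalize (d n - S)); split; [|exact: rn_normalize|].
    by move=> v vs; rewrite dotZl pr ?mulr0.
  move=> x px; rewrite -(subrK S (d n)) dotDr pS ?addr0; last first.
    by move=> u us; apply: px; rewrite mem_rcons inE us orbT.
  rewrite (normalizeK rn0) dotZr px ?mulr0//.
  by rewrite mem_rcons inE eqxx.
exists e; split.
  have e1 n : rn (e n) = 1 by have [_ []] := he n.
  have eperp m n : (n < m)%N -> '[e m, e n] = 0.
    move=> nm; have [_ [h _ _]] := he m; apply: h.
    by apply/mapP; exists n => //; rewrite mem_iota.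
  move=> i j; case: ltngtP => [ij|ji|->]; last by rewrite (dotxx norm_dot) e1 expr1n.
    by rewrite (dotC dot) eperp// conjC0.
  by rewrite eperp.
move=> x px.
have xd n : '[x, d n] = 0.
  have [_ [_ _]] := he n; rewrite size_mkseq; apply=> v.
  by rewrite -mkseqS => /mapP[k _ ->].
apply/eqP; rewrite -rn_eq0; apply: contraT => xn0.
have xp : 0 < rn x by rewrite lt_neqAle eq_sym xn0 rn_ge0.
have [n hn] := hd x _ xp.
have := CauchySchwarz norm_dot x (x - d n).
rewrite dotBr xd subr0 (dotxx norm_dot) rnR ger0_norm ?sqr_ge0// expr2.
by rewrite ler_pM2l// leNgt hn.
Qed.

End Compact.

(** * The rearrangement inequality *)

Section RearrangementInequality.
Context {R : realType}.
Implicit Types a b x y : nat -> R.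

(** Abel summation: the weights are decreasing, so comparing all partial sums
    suffices. *)
Lemma abel_le a x y n : nonincreasing_seq a -> (forall i, 0 <= a i) ->
  (forall k, (k <= n)%N -> \sum_(i < k) x i <= \sum_(i < k) y i) ->
  \sum_(i < n) a i * x i <= \sum_(i < n) a i * y i.
Proof.
move=> am a0 xy; rewrite -subr_ge0 -sumrB.
under eq_bigr do rewrite -mulrBr.
have z0 k : (k <= n)%N -> 0 <= \sum_(i < k) (y i - x i).
  by move=> kn; rewrite sumrB subr_ge0 xy.
suff h k : (k <= n)%N -> a k * \sum_(i < k) (y i - x i) <= \sum_(i < k) a i * (y i - x i).
  by apply: le_trans (h n (leqnn _)); rewrite mulr_ge0// z0.
elim: k => [|k IH] kn; first by rewrite !big_ord0 mulr0.
apply: (@le_trans _ _ (a k * \sum_(i < k.+1) (y i - x i))).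
  by rewrite ler_wpM2r ?z0// am.
by rewrite !big_ord_recr/= mulrDr lerD2r IH// ltnW.
Qed.

(** A matrix with row and column sums at most one does not do better than the
    identity matching between sorted sequences.  Summation by parts in one
    index and then in the other reduces to the indicator sequences of initial
    segments, where the mass of the [k] by [l] corner is at most [min k l]. *)
Lemma substochastic_le a b (D : nat -> nat -> R) n :
  nonincreasing_seq a -> nonincreasing_seq b ->
  (forall i, 0 <= a i) -> (forall i, 0 <= b i) -> (forall i j, 0 <= D i j) ->
  (forall i m, \sum_(j < m) D i j <= 1) -> (forall j m, \sum_(i < m) D i j <= 1) ->
  \sum_(i < n) \sum_(j < n) a i * b j * D i j <= \sum_(k < n) a k * b k.
Proof.
move=> am bm a0 b0 D0 Dr Dc.
under eq_bigr do under eq_bigr do rewrite -mulrA.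
under eq_bigr do rewrite -mulr_sumr.
apply: (@abel_le a (fun i => \sum_(j < n) b j * D i j) b) => // k kn.
rewrite exchange_big/=; under eq_bigr do rewrite -mulr_sumr.
apply: (@le_trans _ _ (\sum_(j < n) b j * (j < k)%:R)); last first.
  rewrite (big_ord_widen n b kn) [leRHS]big_mkcond/=; apply: ler_sum => j _.
  by case: ifP; rewrite ?mulr1 ?mulr0.
apply: (@abel_le b (fun j => \sum_(i < k) D i j) (fun j => (j < k)%:R)) => // l ln.
case: (leqP l k) => lk.
  apply: ler_sum => j _; rewrite (leq_trans (ltn_ord j) lk); exact: Dc.
rewrite exchange_big/=; apply: (@le_trans _ _ (\sum_(i < k) 1)).
  by apply: ler_sum => i _; exact: Dr.
rewrite (big_ord_widen l (fun=> 1) (ltnW lk)) [leLHS]big_mkcond/=; apply: ler_sum => j _.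
by case: ifP.
Qed.

(** Beyond some [K] the sum is dominated by the tail of [sum a_k b_k]; the first
    [K] terms are small because the shifted [a] is. *)
Lemma shifted_product_small a b (B : R) : (forall i, 0 <= a i) -> (forall i, 0 <= b i) ->
  nonincreasing_seq a -> vanishing a -> (forall n, \sum_(k < n) a k * b k <= B) ->
  forall e, 0 < e -> exists I, forall I', (I <= I')%N ->
    forall n, \sum_(k < n) a (I' + k)%N * b k <= e.
Proof.
move=> a0 b0 am av abB e e0; have e2 : 0 < e / 2 by rewrite divr_gt0.
have ab0 i : 0 <= a i * b i by rewrite mulr_ge0.
have [K hK] := bounded_series_tail ab0 abB e2.
have S0 : 0 < \sum_(k < K) b k + 1 by rewrite ltr_wpDl// sumr_ge0.
have [|I hI] := av (e / 2 / (\sum_(k < K) b k + 1)); first by rewrite divr_gt0.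
exists I => I' II n.
apply: (@le_trans _ _ (\sum_(k < K + n) a (I' + k)%N * b k)).
  rewrite addnC big_split_ord/= lerDl sumr_ge0// => i _; by rewrite mulr_ge0.
have := hK (K + n)%N; rewrite !big_split_ord/= ltrD2l => /ltW h.
rewrite (splitr e); apply: lerD; last first.
  apply: le_trans h; apply: ler_sum => i _; rewrite ler_wpM2r// am//.
  exact: leq_addl.
apply: (@le_trans _ _ (\sum_(i < K) (e / 2 / (\sum_(k < K) b k + 1)) * b i)).
  apply: ler_sum => i _; rewrite ler_wpM2r//.
  by have := hI _ (leq_trans II (leq_addr i I')); rewrite ger0_norm// => /ltW.
rewrite -mulr_sumr -mulrA ler_piMr ?ltW//.
by rewrite mulrC ltr_pdivrMr// mul1r ltrDl.
Qed.

Lemma abs_summable_lim (r : nat -> R) (B : R) : (forall n, \sum_(i < n) `|r i| <= B) ->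
  exists l : R, tends (fun n => (\sum_(i < n) r i)%:C) l%:C.
Proof.
move=> rB; have : cvgn (series r).
  apply: normed_cvg; apply: nondecreasing_is_cvgn.
    apply: nondecreasing_series => n _ _; exact: normr_ge0.
  by exists B => _ [n _ <-] /=; rewrite /series/= big_mkord.
move/cvg_ex => [l /cvgrPdist_lt hl]; exists l => e e0.
have [N _ hN] := hl e e0; exists N => n /hN /=.
by rewrite -rmorphB rnR distrC /series/= big_mkord.
Qed.

(** Each [k] accounts for a single index, and vanishing terms cost nothing. *)
Lemma sum_le_reindex (F : nat -> R) (s : nat -> nat) n N :
  (forall i, 0 <= F i) -> (forall i, (i < n)%N -> 0 < F i -> exists2 k, (k < N)%N & s k = i) ->
  \sum_(i < n) F i <= \sum_(k < N) F (s k).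
Proof.
move=> F0 Fs.
apply: (@le_trans _ _ (\sum_(i < n) \sum_(k < N) (s k == i)%:R * F (s k))).
  apply: ler_sum => i _; have [Fi|Fi] := ltP 0 (F i); last first.
    by apply: le_trans Fi _; apply: sumr_ge0 => k _; rewrite mulr_ge0.
  have [k kN ki] := Fs _ (ltn_ord i) Fi.
  rewrite (bigD1 (Ordinal kN))//= ki eqxx mul1r lerDl sumr_ge0// => j _.
  by rewrite mulr_ge0.
rewrite exchange_big; apply: ler_sum => k _; rewrite -mulr_suml ler_piMl//.
have [kn|kn] := ltnP (s k) n; last first.
  by rewrite big1// => i _; rewrite gtn_eqF// (leq_trans _ kn).
rewrite (bigD1 (Ordinal kn))//= eqxx big1 ?addr0// => i ik.
by rewrite (_ : (_ == _) = false)//; apply: contraNF ik => /eqP ki; apply/eqP/val_inj.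
Qed.

End RearrangementInequality.

(** * Traces of products of diagonal operators *)

Section Trace.
Context {R : realType} {H : completeNormedModType R[i]}.
Variable dot : {dot H for Num.conj}.
Hypothesis norm_dot : forall x : H, `|x| ^+ 2 = dot x x.
Local Notation "''[' u , v ]" := (dot u%R v%R) : ring_scope.

(** Arithmetic-geometric mean and Bessel's inequality. *)
Lemma kernel_row g x y n : orthonormal_seq dot g -> rn x <= 1 -> rn y <= 1 ->
  \sum_(j < n) rn '[x, g j] * rn '[g j, y] <= 1.
Proof.
move=> og x1 y1.
apply: (@le_trans _ _ (\sum_(j < n) (rn '[x, g j] ^+ 2 / 2 + rn '[y, g j] ^+ 2 / 2))).
  apply: ler_sum => j _; rewrite (rn_dotC dot (g j)).
  by have := sqr_ge0 (rn '[x, g j] - rn '[y, g j]); nra.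
rewrite big_split/= -!mulr_suml.
have := bessel norm_dot og x n; have := bessel norm_dot og y n.
have : rn x ^+ 2 <= 1 by rewrite expr_le1 ?rn_ge0.
have : rn y ^+ 2 <= 1 by rewrite expr_le1 ?rn_ge0.
lra.
Qed.

Lemma phase (z : R[i]) : exists2 th : R[i], rn th <= 1 & th * z = (rn z)%:C.
Proof.
have [->|z0] := eqVneq z 0; first by exists 0; rewrite ?rn0 ?mul0r.
exists ((rn z)%:C / z); last by rewrite divfK.
have : rn ((rn z)%:C / z) * rn z = rn z by rewrite -rnM divfK// rnR ger0_norm// rn_ge0.
have rz : rn z != 0 by rewrite rn_eq0.
by rewrite -[X in _ = X]mul1r => /(mulIf rz) ->.
Qed.

(** The contractions used are the identity and the projections on the first
    vectors of a basis.  They interpolate between the sum over an arbitrary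
    basis and the sum over the eigenvectors of [C]. *)
Definition contraction (K : H -> H) := symmetric_op dot K /\ forall x, rn (K x) <= rn x.

Lemma contraction_id : contraction id.
Proof. by split. Qed.

Definition proj (e : nat -> H) n (x : H) := \sum_(k < n) '[x, e k] *: e k.

Lemma contraction_proj e n : orthonormal_seq dot e -> contraction (proj e n).
Proof.
move=> oe; split=> [x y|x].
  rewrite dot_suml dot_sumr; apply: eq_bigr => k _.
  by rewrite dotZl dotZr -(dotC dot) mulrC.
rewrite -(@ler_pXn2r _ 2)// ?nnegrE ?rn_ge0//.
by rewrite (rn_comb norm_dot oe (fun k => '[x, e k])) bessel.
Qed.

Lemma proj_tends e x : orthonormal_basis dot e -> tends (proj e ^~ x) x.
Proof.
move=> [oe eb]; have [y hy px] := projection norm_dot oe x.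
by rewrite (_ : x = y) in hy *; last by apply/subr0_eq/eb.
Qed.

Variables (C T : H -> H) (c t : nat -> R) (f g : nat -> H).
Hypotheses (of_ : orthonormal_seq dot f) (og : orthonormal_seq dot g).
Hypotheses (Cd : diagonal dot C c f) (Td : diagonal dot T t g).
Hypotheses (cm : nonincreasing_seq (fun i => `|c i|))
           (tm : nonincreasing_seq (fun i => `|t i|)).

Let T_sym : symmetric_op dot T. Proof. by case: Td. Qed.

(** The contribution of the [i]-th eigenvector of [C] to the trace of [K C T]. *)
Definition trace_term (K : H -> H) i := (c i)%:C * '[K (f i), T (f i)].

(** Expanding [T] along its eigenvectors bounds the [i]-th term by
    [sum_j |c_i| |t_j| D i j] with
    [D i j = |<K f_i, g_j>| |<g_j, f_i>|], a matrix which is substochastic in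
    both directions because [K] is a symmetric contraction.  The rearrangement
    inequality then gives a bound independent of [K]. *)
Lemma trace_term_bound K I (B : R) n : contraction K ->
  (forall N, \sum_(k < N) `|c (I + k)%N| * `|t k| <= B) ->
  \sum_(i < n) rn (trace_term K (I + i)%N) <= B.
Proof.
move=> [Ks K1] hB.
(* Phases th turn the sum of absolute values into the absolute value of a sum,
   through which the limit over the eigenvectors of T can be taken. *)
have /choice[th hth] (i : nat) : exists th : R[i], rn th <= 1 /\
    th * trace_term K (I + i)%N = (rn (trace_term K (I + i)%N))%:C.
  by have [u u1 hu] := phase (trace_term K (I + i)%N); exists u.
have B0 : 0 <= B by have := hB 0%N; rewrite big_ord0.
have -> : \sum_(i < n) rn (trace_term K (I + i)%N) =
    rn (\sum_(i < n) th i * trace_term K (I + i)%N).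
  under [in RHS]eq_bigr do rewrite (hth _).2.
  by rewrite -rmorph_sum/= rnR ger0_norm// sumr_ge0// => i _; exact: rn_ge0.
have lim i : tends (fun J => Num.conj (th i) * (c (I + i)%N)%:C *
    \sum_(j < J) (t j)%:C * '[f (I + i)%N, g j] * '[g j, K (f (I + i)%N)])
    (Num.conj (th i * trace_term K (I + i)%N)).
  rewrite /trace_term !rmorphM/= conjR mulrA -(dotC dot).
  exact/tendsMl/(diagonal_expansion norm_dot og Td).
rewrite -[X in X <= _]rn_conj rmorph_sum/=.
apply: (tends_rn_le (tends_sum (fun i : 'I_n => lim i))); exists n => J nJ.
apply: le_trans (rn_sum _ _ _) _.
pose a i := `|c (I + i)%N|; pose b j := `|t j|.
pose D i j := rn '[K (f (I + i)%N), g j] * rn '[g j, f (I + i)%N].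
apply: (@le_trans _ _ (\sum_(i < n) \sum_(j < J) a i * b j * D i j)).
  apply: ler_sum => i _; rewrite !rnM rn_conj rnR -/(a i).
  apply: (@le_trans _ _ (a i * rn (\sum_(j < J) (t j)%:C *
      '[f (I + i)%N, g j] * '[g j, K (f (I + i)%N)]))).
    rewrite -mulrA ler_piMl ?mulr_ge0 ?rn_ge0 ?normr_ge0//.
    by have [] := hth i.
  apply: (@le_trans _ _ (a i * \sum_(j < J) rn ((t j)%:C *
      '[f (I + i)%N, g j] * '[g j, K (f (I + i)%N)]))).
    by rewrite ler_wpM2l ?normr_ge0// rn_sum.
  rewrite mulr_sumr; apply: ler_sum => j _.
  rewrite !rnM rnR (rn_dotC dot (f _)) (rn_dotC dot (g j) (K _)) /D /b.
  by rewrite le_eqVlt; apply/orP; left; apply/eqP; ring.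
apply: (@le_trans _ _ (\sum_(i < J) \sum_(j < J) a i * b j * D i j)).
  rewrite (big_ord_widen J (fun i => \sum_(j < J) a i * b j * D i j) nJ) [leLHS]big_mkcond/=.
  apply: ler_sum => i _; case: ifP => // _; apply: sumr_ge0 => j _.
  by rewrite !mulr_ge0 ?normr_ge0 ?rn_ge0.
apply: le_trans (hB J); apply: substochastic_le => //.
- by move=> i j ij; apply: cm; rewrite leq_add2l.
- by move=> i; exact: normr_ge0.
- by move=> i; exact: normr_ge0.
- by move=> i j; rewrite mulr_ge0 ?rn_ge0.
- move=> i m; apply: kernel_row => //; last by rewrite (orthonormal_rn norm_dot of_).
  by rewrite -(orthonormal_rn norm_dot of_ (I + i)%N) K1.
- move=> j m; rewrite /D.
  under eq_bigr do rewrite Ks (rn_dotC dot _ (K _)) (rn_dotC dot (g j)) (rn_dotC dot _ (g j)).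
  have of' : orthonormal_seq dot (f \o addn I).
    by apply: (orthonormal_reindex of_); exact: addnI.
  under eq_bigr do rewrite (rn_dotC dot (g j)).
  apply: (@kernel_row (f \o addn I)) => //; last by rewrite (orthonormal_rn norm_dot og).
  by rewrite -(orthonormal_rn norm_dot og j) K1.
Qed.

Lemma tends_tail (u : nat -> R[i]) l I (e : R) : tends (fun n => \sum_(i < n) u i) l ->
  (forall n, \sum_(i < n) rn (u (I + i)%N) <= e) -> rn (l - \sum_(i < I) u i) <= e.
Proof.
move=> ul h; apply: (tends_rn_le (tendsB ul (tends_cst _))); exists I => n In.
rewrite -(subnKC In) big_split_ord/= addrAC subrr add0r.
exact: le_trans (rn_sum _ _ _) (h _).
Qed.

Lemma trace_term_real i : trace_term id i = (c i * complex.Re '[T (f i), f i])%:C.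
Proof. by rewrite /trace_term -T_sym (sym_real T_sym) rmorphM. Qed.

Hypothesis cv : vanishing c.
Variable B : R.
Hypothesis ctB : forall n, \sum_(k < n) `|c k| * `|t k| <= B.

Let abs_vanishing : vanishing (fun i => `|c i|).
Proof. by apply: vanishing_le cv => i; rewrite normr_id. Qed.

(** Tails of the trace are small uniformly in [K]: this is what allows to
    exchange the limit over the basis with the sum over the eigenvectors. *)
Lemma tail_small (e : R) : 0 < e -> exists I, forall I', (I <= I')%N ->
  forall K, contraction K -> forall n, \sum_(i < n) rn (trace_term K (I' + i)%N) <= e.
Proof.
move=> e0.
have [I hI] := shifted_product_small (fun i => normr_ge0 (c i)) (fun i => normr_ge0 (t i))
  cm abs_vanishing ctB e0.
exists I => I' II K Kc n; apply: trace_term_bound => // N; exact: hI.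
Qed.

Lemma trace_terms_lim : exists tau : R, tends (fun n => \sum_(i < n) trace_term id i) tau%:C.
Proof.
have [|tau h] := @abs_summable_lim _ (fun i => c i * complex.Re '[T (f i), f i]) B.
  move=> n; apply: le_trans (_ : \sum_(i < n) rn (trace_term id (0 + i)%N) <= _).
    by apply: ler_sum => i _; rewrite trace_term_real rnR.
  by apply: trace_term_bound; [exact: contraction_id|exact: ctB].
exists tau; move: h; congr tends; apply/funext => n.
by rewrite rmorph_sum; apply: eq_bigr => i _; rewrite trace_term_real.
Qed.

(** Partial sums of the trace over any basis are sums over the eigenvectors of
    [C], with [K] the projection on the first basis vectors. *)
Lemma trace_term_proj e n : orthonormal_seq dot e ->
  tends (fun I => \sum_(i < I) trace_term (proj e n) i) (\sum_(k < n) '[C (T (e k)), e k]).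
Proof.
move=> oe.
have := tends_sum (fun k : 'I_n => diagonal_expansion norm_dot of_ Cd (T (e k)) (e k)).
congr tends; apply/funext => I; rewrite exchange_big/=; apply: eq_bigr => i _.
rewrite /trace_term /proj dot_suml mulr_sumr; apply: eq_bigr => k _.
by rewrite dotZl -T_sym; ring.
Qed.

(** Up to a small tail, uniformly in the projections [K = proj e n], only finitely
    many eigenvectors of [C] contribute, and for each of them [proj e n (f i)]
    tends to [f i].  The value does not depend on the basis. *)
Lemma trace_expansion tau : tends (fun n => \sum_(i < n) trace_term id i) tau%:C ->
  is_trace dot (C \o T) tau%:C.
Proof.
move=> htau e eb; have [oe _] := eb; apply/(cvg_tendsP (H := R[i]^o)) => eps eps0.
have e4 : 0 < eps / 4 by rewrite divr_gt0.
have [I /(_ I (leqnn _)) hI] := tail_small e4.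
have h1 n := tends_tail (trace_term_proj n oe) (hI _ (contraction_proj n oe)).
have h2 := tends_tail htau (hI _ contraction_id).
have h3 : tends (fun n => \sum_(i < I) trace_term (proj e n) i) (\sum_(i < I) trace_term id i).
  apply: (tends_sum (u := fun i n => trace_term (proj e n) i)) => i; apply: tendsMl.
  exact/(tends_dotl norm_dot)/proj_tends.
have [N hN] := h3 _ e4; exists N => n /hN; have := h1 n; move: h2 => /=.
set S := \sum_(k < n) _; set A := \sum_(i < I) _; set A' := \sum_(i < I) _ => h2' h1' h4.
have -> : S - tau%:C = (S - A') + ((A' - A) + (A - tau%:C)) by ring.
apply: le_lt_trans (rnD _ _) _; have := rnD (A' - A) (A - tau%:C).
move: h2'; rewrite (rnBC tau%:C) => h2'; lra.
Qed.

End Trace.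

(** * Extension of finite partial isometries to unitaries *)

Section Unitaries.
Context {R : realType} {H : completeNormedModType R[i]}.
Variable dot : {dot H for Num.conj}.
Hypothesis norm_dot : forall x : H, `|x| ^+ 2 = dot x x.
Local Notation "''[' u , v ]" := (dot u%R v%R) : ring_scope.

(** A unitary with its inverse, which is its adjoint.  Linearity and continuity
    follow. *)
Definition unitary_pair (U V : H -> H) :=
  [/\ forall x y, '[U x, y] = '[x, V y], cancel U V & cancel V U].

Lemma unitary_pair_dot U V x y : unitary_pair U V -> '[U x, U y] = '[x, y].
Proof. by case=> UV UK _; rewrite UV UK. Qed.

Lemma unitary_pair_adjoint U V : unitary_pair U V -> adjoint dot U = V.
Proof. by case=> UV _ _; exact: adjointE. Qed.

Lemma unitary_pair_unitary U V : unitary_pair U V -> unitary dot U.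
Proof.
move=> UVp; have [UV UK VK] := UVp; rewrite /unitary (unitary_pair_adjoint UVp).
have Ul : linear U.
  move=> a x y; apply: (dot_inj norm_dot) => z.
  by rewrite dotDl dotZl !UV dotDl dotZl.
split=> //; try by apply/funext.
apply: (@additive_bounded_continuous _ _ _ 1).
  by move=> x y; rewrite -[x - y]addrC -scaleN1r Ul scaleN1r addrC.
move=> x; rewrite mul1r -(@ler_pXn2r _ 2)// ?nnegrE ?rn_ge0//.
by rewrite -lecR -!(dotxx norm_dot) (unitary_pair_dot _ _ UVp).
Qed.

Lemma unitary_pairP U : unitary dot U -> unitary_pair U (adjoint dot U).
Proof.
move=> Uu; have [_ _ U1 U2] := Uu; split.
- exact: (unitary_adjoint Uu).
- by move=> x; have := congr1 (@^~ x) U1.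
- by move=> x; have := congr1 (@^~ x) U2.
Qed.

Lemma unitary_pair_id : unitary_pair id id.
Proof. by split. Qed.

Lemma unitary_pair_comp U V U' V' : unitary_pair U V -> unitary_pair U' V' ->
  unitary_pair (U' \o U) (V \o V').
Proof.
move=> [UV UK VK] [UV' UK' VK']; split.
- by move=> x y /=; rewrite UV' UV.
- exact: can_comp.
- exact: can_comp.
Qed.

(** The perturbation [1 - z^-1 v v^*] is unitary exactly when
    [|v|^2 = z + conj z]. *)
Lemma rank_one_unitary v (z : R[i]) : z != 0 -> '[v, v] = z + Num.conj z ->
  unitary_pair (fun x => x - ('[x, v] / z) *: v) (fun x => x - ('[x, v] / Num.conj z) *: v).
Proof.
move=> z0 vv; have z0' : Num.conj z != 0 by rewrite conjC_eq0.
split=> [x y|x|x] /=.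
- rewrite dotBl dotBr dotZl dotZr (dotC dot y v) rmorphM fmorphV/= !conjCK.
  by field.
- rewrite -addrA -opprD -scalerDl dotBl dotZl vv.
  rewrite [X in X *: v](_ : _ = 0) ?scale0r ?subr0//.
  by field; rewrite z0 z0'.
- rewrite -addrA -opprD -scalerDl dotBl dotZl vv.
  rewrite [X in X *: v](_ : _ = 0) ?scale0r ?subr0//.
  by field; rewrite z0 z0'.
Qed.

(** A complex Householder reflection: with [v = h - g] and [z = <h, v>], the map
    [x - (<x, v> / z) v] sends [h] to [h - v = g] even when [<h, g>] is not real. *)
Lemma householder h g : rn h = 1 -> rn g = 1 -> exists W W', [/\ unitary_pair W W', W h = g &
  forall x, '[x, h] = 0 -> '[x, g] = 0 -> W x = x].
Proof.
move=> h1 g1; have [->|hg] := eqVneq h g.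
  by exists id, id; split=> //; exact: unitary_pair_id.
have hh : '[h, h] = 1 by rewrite (dotxx norm_dot) h1 expr1n.
have gg : '[g, g] = 1 by rewrite (dotxx norm_dot) g1 expr1n.
pose z := '[h, h - g].
have vv : '[h - g, h - g] = z + Num.conj z.
  rewrite dotBl -/z /z !dotBr hh gg rmorphB rmorph1/= -(dotC dot); ring.
have z0 : z != 0.
  apply: contraNneq hg => z0; apply/eqP/subr0_eq/(dot_eq0 norm_dot).
  by rewrite vv z0 conjC0 addr0.
exists (fun x => x - ('[x, h - g] / z) *: (h - g)),
  (fun x => x - ('[x, h - g] / Num.conj z) *: (h - g)).
split; first exact: rank_one_unitary.
- by rewrite -/z divff// scale1r opprB addrC subrK.
- by move=> x xh xg; rewrite dotBr xh xg subrr mul0r scale0r subr0.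
Qed.

(** Correct the images one at a time by Householder reflections; each fixes the
    vectors already placed, since these are orthogonal to both the current
    image of the next vector and its target. *)
Lemma unitary_extension (f g : nat -> H) m :
  (forall i j, (i < m)%N -> (j < m)%N -> '[f i, f j] = (i == j)%:R) ->
  (forall i j, (i < m)%N -> (j < m)%N -> '[g i, g j] = (i == j)%:R) ->
  exists U V, unitary_pair U V /\ forall i, (i < m)%N -> U (f i) = g i.
Proof.
elim: m => [|m IH] fo go.
  by exists id, id; split=> //; exact: unitary_pair_id.
have [|i j im jm|U [V [UV Uf]]] := IH; [by move=> i j im jm; apply: fo; exact: ltnW|
  by apply: go; exact: ltnW|].
have unit_of (x : H) : '[x, x] = 1 -> rn x = 1.
  by rewrite (dotxx norm_dot) => /complexI/eqP; rewrite sqrp_eq1 ?rn_ge0// => /eqP.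
have [||W [W' [WW' Wf Wfix]]] := @householder (U (f m)) (g m).
- by apply: unit_of; rewrite (unitary_pair_dot _ _ UV) fo ?eqxx.
- by apply: unit_of; rewrite go ?eqxx.
exists (W \o U), (V \o W'); split; first exact: unitary_pair_comp.
move=> i; rewrite ltnS leq_eqVlt => /predU1P[->//|im].
rewrite /= Uf// Wfix// ?go ?(ltn_eqF im) ?(ltnW im) ?ltnS// ?(ltnW im)//.
by rewrite -Uf// (unitary_pair_dot _ _ UV) fo ?(ltn_eqF im) ?(ltnW im) ?ltnS// ?(ltnW im).
Qed.

Lemma conjugate_diagonal U V T t g : unitary_pair U V -> diagonal dot T t g ->
  diagonal dot (V \o T \o U) t (V \o g).
Proof.
move=> [UV UK VK] [Ts Tg T0].
have V0 : V 0 = 0.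
  by apply: (dot_eq0 norm_dot); rewrite -UV dot0r.
split=> [x y|i|x px].
- by rewrite /= -UV -Ts; rewrite (dotC dot) -UV -(dotC dot).
- rewrite /= VK Tg; apply: (dot_inj norm_dot) => z.
  by rewrite dotZl ![LHS](dotC dot) -UV dotZr rmorphM/= conjCK UV -(dotC dot).
- by rewrite /= T0// => i; rewrite UV; exact: px.
Qed.

Lemma conjugate_orthonormal U V g : unitary_pair U V -> orthonormal_seq dot g ->
  orthonormal_seq dot (V \o g).
Proof. by move=> [UV UK VK] og i j; rewrite /= -UV VK. Qed.

End Unitaries.

(** * The upper bound and its approximation by unitaries *)

Section Approach.
Context {R : realType} {H : completeNormedModType R[i]}.
Variable dot : {dot H for Num.conj}.
Hypothesis norm_dot : forall x : H, `|x| ^+ 2 = dot x x.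
Local Notation "''[' u , v ]" := (dot u%R v%R) : ring_scope.
Variables (C T : H -> H) (c t : nat -> R) (f g : nat -> H).
Hypotheses (of_ : orthonormal_seq dot f) (og : orthonormal_seq dot g).
Hypotheses (Cd : diagonal dot C c f) (Td : diagonal dot T t g).
Hypotheses (cm : nonincreasing_seq (fun i => `|c i|))
           (tm : nonincreasing_seq (fun i => `|t i|)).
Hypotheses (cv : vanishing c) (tv : vanishing t).
Variable B : R.
Hypothesis ctB : forall n, \sum_(k < n) `|c k| * `|t k| <= B.

Lemma tends_Re_le (u : nat -> R[i]) l (W : R) : tends u l ->
  (forall n, complex.Re (u n) <= W) -> complex.Re l <= W.
Proof.
move=> ul uW; apply/ler_addgt0Pr => e e0; have [N /(_ N (leqnn _))] := ul _ e0.
rewrite rnBC => h; have := Re_le_rn (l - u N); have := uW N.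
by rewrite raddfB /=; lra.
Qed.

Lemma cover_bounded (u : nat -> R) (s : nat -> nat) n :
  (forall i, 0 < u i -> exists k, s k = i) ->
  exists N, forall i, (i < n)%N -> 0 < u i -> exists2 k, (k < N)%N & s k = i.
Proof.
move=> us; elim: n => [|n [N hN]]; first by exists 0%N.
have [un|un] := ltP 0 (u n); last first.
  exists N => i; rewrite ltnS leq_eqVlt => /predU1P[->|/hN//].
  by rewrite ltNge un.
have [k sk] := us _ un; exists (maxn N k.+1) => i.
rewrite ltnS leq_eqVlt => /predU1P[-> _|/hN h /h[j jN sj]].
  by exists k => //; rewrite leq_max ltnSn orbT.
by exists j => //; rewrite leq_max jN.
Qed.

(** [s] enumerates the indices so that [u] decreases, reaching every positive
    entry: what [eigenvalue_seq_rearrangement] provides. *)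
Definition sorts (u : nat -> R) (s : nat -> nat) :=
  [/\ injective s, nonincreasing_seq (u \o s) & forall i, 0 < u i -> exists k, s k = i].

Let w i j := rn '[f i, g j] ^+ 2.

(** The weights [|<f_i, g_j>|^2] are substochastic by Bessel, so the rearrangement
    inequality applies after sorting both sequences. *)
Lemma weighted_sum_le (u v : nat -> R) s s' n J :
  (forall i, 0 <= u i) -> (forall i, 0 <= v i) -> sorts u s -> sorts v s' ->
  exists N0, forall N, (N0 <= N)%N ->
    \sum_(i < n) \sum_(j < J) u i * v j * w i j <= \sum_(k < N) u (s k) * v (s' k).
Proof.
move=> u0 v0 [sI sm us] [sI' sm' vs].
have w0 i j : 0 <= w i j by exact: sqr_ge0.
have [N1 h1] := cover_bounded n us; have [N2 h2] := cover_bounded J vs.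
exists (maxn N1 N2) => N; rewrite geq_max => /andP[N1N N2N].
apply: (@le_trans _ _ (\sum_(i < n) \sum_(l < N) u i * v (s' l) * w i (s' l))).
  apply: ler_sum => i _; apply: (@sum_le_reindex _ (fun j => u i * v j * w i j)) => [j|j jJ].
    by rewrite !mulr_ge0.
  move=> h; have vj : 0 < v j.
    by rewrite lt_neqAle v0 andbT; apply: contraTneq h => <-; rewrite mulr0 mul0r ltxx.
  by have [k kN sk] := h2 _ jJ vj; exists k => //; exact: leq_trans N2N.
apply: (@le_trans _ _ (\sum_(k < N) \sum_(l < N) u (s k) * v (s' l) * w (s k) (s' l))).
  apply: (@sum_le_reindex _ (fun i => \sum_(l < N) u i * v (s' l) * w i (s' l))) => [i|i im h].
    by apply: sumr_ge0 => l _; rewrite !mulr_ge0.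
  have ui : 0 < u i.
    rewrite lt_neqAle u0 andbT; apply: contraTneq h => <-.
    by rewrite big1 ?ltxx// => l _; rewrite !mul0r.
  by have [k kN sk] := h1 _ im ui; exists k => //; exact: leq_trans N1N.
have row h (q : nat -> H) m : orthonormal_seq dot q -> rn h = 1 ->
  \sum_(j < m) rn '[h, q j] ^+ 2 <= 1.
  by move=> oq h1'; apply: le_trans (bessel norm_dot oq h m) _; rewrite h1' expr1n.
apply: (@substochastic_le _ (u \o s) (v \o s') (fun k l => w (s k) (s' l))) => //.
- by move=> i /=.
- by move=> i /=.
- move=> i m; apply: (row _ (g \o s')); last exact: (orthonormal_rn norm_dot of_).
  exact: orthonormal_reindex.
- move=> j m; rewrite /w; under eq_bigr do rewrite rn_dotC.
  apply: (row _ (f \o s)); last exact: (orthonormal_rn norm_dot og).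
  exact: orthonormal_reindex.
Qed.

Variables (sp sn tp tn : nat -> nat).
Hypotheses (hsp : sorts (posp c) sp) (hsn : sorts (negp c) sn).
Hypotheses (htp : sorts (posp t) tp) (htn : sorts (negp t) tn).

Definition upper_term k :=
  posp c (sp k) * posp t (tp k) + negp c (sn k) * negp t (tn k).

Lemma product_le i j : c i * t j <= posp c i * posp t j + negp c i * negp t j.
Proof.
rewrite /posp /negp; have := normr_ge0 (c i); have := normr_ge0 (t j).
have := ler_norm (c i * t j); rewrite normrM; lra.
Qed.

(** In [sum c_i t_j |<f_i, g_j>|^2], drop the negative products
    [c^+ t^-] and [c^- t^+] and apply the rearrangement inequality to the two
    remaining sums. *)
Lemma trace_upper tau (W : R) : tends (fun n => \sum_(i < n) trace_term dot T c f id i) tau%:C ->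
  (forall N, \sum_(k < N) upper_term k <= W) -> tau <= W.
Proof.
move=> htau hW; rewrite -[tau]/(complex.Re tau%:C); apply: (tends_Re_le htau) => n.
have [Ts _ _] := Td.
have lim i : tends (fun J => (c i)%:C * \sum_(j < J) (t j)%:C * '[f i, g j] * '[g j, f i])
    (trace_term dot T c f id i).
  rewrite /trace_term -Ts; apply: tendsMl.
  exact: (diagonal_expansion norm_dot og Td).
apply: (tends_Re_le (tends_sum (fun i : 'I_n => lim i))) => J.
have [N1 h1] := weighted_sum_le n J (posp_ge0 c) (posp_ge0 t) hsp htp.
have [N2 h2] := weighted_sum_le n J (negp_ge0 c) (negp_ge0 t) hsn htn.
apply: le_trans (hW (maxn N1 N2)); rewrite big_split/=.
apply: le_trans (lerD (h1 _ (leq_maxl _ _)) (h2 _ (leq_maxr _ _))).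
rewrite -big_split/= (_ : \sum_(i < n) _ =
   (\sum_(i < n) \sum_(j < J) c i * t j * w i j)%:C); last first.
  rewrite rmorph_sum; apply: eq_bigr => i _ /=; rewrite mulr_sumr rmorph_sum.
  apply: eq_bigr => j _ /=; rewrite (dotC dot (g j)) -mulrA -rn_sqr.
  by rewrite -!rmorphM mulrA.
apply: ler_sum => i _; rewrite -big_split; apply: ler_sum => j _ /=.
by rewrite -mulrDl ler_wpM2r ?sqr_ge0// product_le.
Qed.

(** Take [L0] so large that the trace terms beyond [L0] are negligible for every
    unitary.  Send each matched eigenvector of [C] to its partner, and every
    other one of the first [L0] to an eigenvector of [T] so far out, at index
    [L + i], that the eigenvalue of [T] there is negligible. *)
Lemma matching_unitary (K : finType) (A : pred K) (S Q : K -> nat) :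
  {in A &, injective S} -> {in A &, injective Q} ->
  forall e, 0 < e -> exists U V tau, [/\ unitary_pair dot U V,
    tends (fun n => \sum_(i < n) trace_term dot (V \o T \o U) c f id i) tau%:C &
    \sum_(k | A k) c (S k) * t (Q k) - e <= tau].
Proof.
move=> SI QI e e0; have e2 : 0 < e / 2 by rewrite divr_gt0.
have abs_v : vanishing (fun i => `|c i|).
  by apply: vanishing_le cv => i; rewrite normr_id.
have [I hI] := shifted_product_small (fun i => normr_ge0 (c i)) (fun i => normr_ge0 (t i))
  cm abs_v ctB e2.
pose L0 := maxn I (\max_(k : K) S k).+1.
have SL0 k : (S k < L0)%N.
  by rewrite leq_max ltnS (@leq_bigmax _ S k) ?orbT.
have S0 : 0 < \sum_(i < L0) `|c i| + 1 by rewrite ltr_wpDl// sumr_ge0.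
have [|I2 hI2] := tv (e := e / 2 / (\sum_(i < L0) `|c i| + 1)); first by rewrite divr_gt0.
pose L := maxn I2 (\max_(k : K) Q k).+1.
have QL k : (Q k < L)%N.
  by rewrite leq_max ltnS (@leq_bigmax _ Q k) ?orbT.
(* m i is the matched pair at index i, if any; p i is the target index. *)
pose m i := [pick k | A k && (S k == i)].
pose p i := if m i is Some k then Q k else (L + i)%N.
have pI : injective p.
  move=> i j; rewrite /p /m.
  case: pickP => [k /andP[Ak /eqP Ski]|_]; case: pickP => [k' /andP[Ak' /eqP Skj]|_].
  - by move=> /(QI _ _ Ak Ak') kk; rewrite -Ski kk.
  - by move=> h; have := QL k; rewrite h ltnNge leq_addr.
  - by move=> h; have := QL k'; rewrite -h ltnNge leq_addr.
  - by move/addnI.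
have og' : orthonormal_seq dot (g \o p) by exact: orthonormal_reindex.
have [|i j _ _|U [V [UV Uf]]] := @unitary_extension _ _ _ norm_dot f (g \o p) L0.
- by move=> i j _ _; exact: of_.
- exact: og'.
have Td' := conjugate_diagonal norm_dot UV Td.
have oV := conjugate_orthonormal UV og.
have [tau htau] := trace_terms_lim norm_dot of_ oV Td' cm tm ctB.
exists U, V, tau; split=> //.
have term i : (i < L0)%N -> trace_term dot (V \o T \o U) c f id i = (c i * t (p i))%:C.
  move=> il; have [UVd UK VK] := UV; have [_ Tg _] := Td.
  rewrite /trace_term /= -UVd Uf//= Tg dotZr conjR og eqxx mulr1.
  by rewrite rmorphM.
have tail : rn (tau%:C - \sum_(i < L0) trace_term dot (V \o T \o U) c f id i) <= e / 2.
  apply: (tends_tail htau) => n; apply: (trace_term_bound norm_dot of_ oV Td' cm tm).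
    exact: contraction_id.
  by move=> N; apply: hI; exact: leq_maxl.
have head : \sum_(i < L0) trace_term dot (V \o T \o U) c f id i =
    (\sum_(i < L0) c i * t (p i))%:C.
  by rewrite rmorph_sum; apply: eq_bigr => i _ /=; rewrite term.
rewrite head -rmorphB rnR in tail.
have : \sum_(k | A k) c (S k) * t (Q k) - e / 2 <= \sum_(i < L0) c i * t (p i); last first.
  by have := ler_norm (- (tau - \sum_(i < L0) c i * t (p i))); rewrite normrN; lra.
pose F i := if m i is Some k then c (S k) * t (Q k) else 0.
have -> : \sum_(k | A k) c (S k) * t (Q k) = \sum_(i < L0) F i.
  transitivity (\sum_(k | A k) \sum_(i < L0) (S k == i)%:R * (c (S k) * t (Q k))).
    apply: eq_bigr => k Ak; rewrite (bigD1 (Ordinal (SL0 k)))//= eqxx mul1r.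
    rewrite big1 ?addr0// => i ik; rewrite (_ : (_ == _) = false) ?mul0r//.
    by apply: contraNF ik => /eqP ki; apply/eqP/val_inj.
  rewrite exchange_big; apply: eq_bigr => i _ /=; rewrite /F /m.
  case: pickP => [k /andP[Ak Ski]|none].
    rewrite (bigD1 k)//= Ski mul1r big1 ?addr0// => k' /andP[Ak' k'k].
    rewrite (_ : (_ == _) = false) ?mul0r//; apply: contraNF k'k => /eqP h.
    by apply/eqP/SI => //; rewrite h (eqP Ski).
  by rewrite big1// => k Ak; have := none k; rewrite Ak/= => ->; rewrite mul0r.
rewrite lerBlDr -lerBlDl -sumrB.
apply: (@le_trans _ _ (\sum_(i < L0) `|c i| * (e / 2 / (\sum_(i < L0) `|c i| + 1)))).
  apply: ler_sum => i _; rewrite /F /p /m; case: pickP => [k /andP[Ak /eqP Ski]|_].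
    by rewrite Ski subrr mulr_ge0// divr_ge0// ltW.
  rewrite sub0r; apply: le_trans (ler_norm _) _; rewrite normrN normrM ler_wpM2l//.
  apply/ltW/hI2; apply: leq_trans (leq_addr _ _); exact: leq_maxl.
rewrite -mulr_suml mulrCA ler_piMr ?(ltW e2)//.
by rewrite ler_pdivrMr// mul1r lerDl.
Qed.

(** Match the [k]-th largest positive eigenvalues with each other, and likewise
    the negative ones, as long as both members of the pair are nonzero. *)
Lemma trace_approach N (e : R) : 0 < e -> exists U V tau, [/\ unitary_pair dot U V,
    tends (fun n => \sum_(i < n) trace_term dot (V \o T \o U) c f id i) tau%:C &
    \sum_(k < N) upper_term k - e <= tau].
Proof.
move=> e0.
have [spI _ _] := hsp; have [snI _ _] := hsn; have [tpI _ _] := htp; have [tnI _ _] := htn.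
(* The boolean distinguishes the positive pairs from the negative ones. *)
pose P (bk : bool * 'I_N) := if bk.1 then posp c (sp bk.2) * posp t (tp bk.2)
  else negp c (sn bk.2) * negp t (tn bk.2).
pose S (bk : bool * 'I_N) := if bk.1 then sp bk.2 else sn bk.2.
pose Q (bk : bool * 'I_N) := if bk.1 then tp bk.2 else tn bk.2.
pose A : pred (bool * 'I_N) := fun bk => 0 < P bk.
have P0 bk : 0 <= P bk.
  by rewrite /P; case: ifP => _; rewrite mulr_ge0 ?posp_ge0 ?negp_ge0.
have mulr_gt0P (x y : R) : 0 <= x -> 0 <= y -> 0 < x * y -> 0 < x /\ 0 < y.
  by move=> x0 y0; rewrite !lt_neqAle x0 y0 !(eq_sym 0) mulf_eq0 negb_or mulr_ge0// !andbT => /andP.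
have posE (a : nat -> R) i : 0 < posp a i -> 0 < a i /\ posp a i = a i.
  by rewrite /posp; case: (ger0P (a i)) => h h'; split; lra.
have negE (a : nat -> R) i : 0 < negp a i -> a i < 0 /\ negp a i = - a i.
  by rewrite /negp; case: (ger0P (a i)) => h h'; split; lra.
have act bk : A bk -> if bk.1 then 0 < c (S bk) /\ 0 < t (Q bk) else c (S bk) < 0 /\ t (Q bk) < 0.
  rewrite /A /P /S /Q; case: bk => -[] k /=.
    by move=> /(mulr_gt0P _ _ (posp_ge0 _ _) (posp_ge0 _ _))[/posE[? _] /posE[? _]].
  by move=> /(mulr_gt0P _ _ (negp_ge0 _ _) (negp_ge0 _ _))[/negE[? _] /negE[? _]].
have PE bk : A bk -> P bk = c (S bk) * t (Q bk).
  rewrite /A /P /S /Q; case: bk => -[] k /=.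
    by move=> /(mulr_gt0P _ _ (posp_ge0 _ _) (posp_ge0 _ _))[/posE[_ ->] /posE[_ ->]].
  by move=> /(mulr_gt0P _ _ (negp_ge0 _ _) (negp_ge0 _ _))[/negE[_ ->] /negE[_ ->]]; rewrite mulrNN.
have [||U [V [tau [UV htau h]]]] := @matching_unitary _ A S Q _ _ e e0.
- move=> [b k] [b' k'] /act h /act h'; move: h h'; rewrite /S /=.
  case: b; case: b' => -[h1 _] [h2 _]; rewrite /= => h.
  + by rewrite (ord_inj (spI _ _ h)).
  + by exfalso; move: h1 h2; rewrite h => h1 h2; have := lt_trans h1 h2; rewrite ltxx.
  + by exfalso; move: h1 h2; rewrite h => h1 h2; have := lt_trans h2 h1; rewrite ltxx.
  + by rewrite (ord_inj (snI _ _ h)).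
- move=> [b k] [b' k'] /act h /act h'; move: h h'; rewrite /Q /=.
  case: b; case: b' => -[_ h1] [_ h2]; rewrite /= => h.
  + by rewrite (ord_inj (tpI _ _ h)).
  + by exfalso; move: h1 h2; rewrite h => h1 h2; have := lt_trans h1 h2; rewrite ltxx.
  + by exfalso; move: h1 h2; rewrite h => h1 h2; have := lt_trans h2 h1; rewrite ltxx.
  + by rewrite (ord_inj (tnI _ _ h)).
exists U, V, tau; split=> //; apply: le_trans h; rewrite lerD2r.
have -> : \sum_(k | A k) c (S k) * t (Q k) = \sum_k P k.
  rewrite big_mkcond/=; apply: eq_bigr => bk _.
  case: ifPn => [Ab|]; first by rewrite PE.
  by rewrite /A -leNgt => Pk; apply/eqP; rewrite eq_le P0 Pk.
rewrite -(pair_bigA _ (fun b k => P (b, k)))/= big_bool /P/=.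
by rewrite big_split.
Qed.

End Approach.

(** * Summability of products of singular numbers *)

Section Summability.
Context {R : realType}.

Lemma nneseries_bounded (a : nat -> R) : (forall i, 0 <= a i) ->
  (\sum_(0 <= n <oo) (a n)%:E < +oo)%E -> exists B : R, forall n, \sum_(i < n) a i <= B.
Proof.
move=> a0 afin; exists (fine (\sum_(0 <= n <oo) (a n)%:E)%E) => n.
rewrite -lee_fin fineK; last first.
  by rewrite ge0_fin_numE//; apply: nneseries_ge0 => i _ _; rewrite lee_fin.
rewrite -sumEFin -(big_mkord xpredT (fun i => (a i)%:E)).
by apply: nneseries_lim_ge => i _ _; rewrite lee_fin.
Qed.

Definition power_summable (p : \bar R) (a : nat -> R) : Prop := match p with
  | r%:E => (\sum_(0 <= n <oo) (a n `^ r)%:E < +oo)%E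
  | +oo%E => True
  | -oo%E => False
  end.

Lemma summable_mul_bounded (a b : nat -> R) : (forall i, 0 <= a i) -> (forall i, 0 <= b i) ->
  power_summable 1%:E a -> vanishing b -> exists B : R, forall n, \sum_(i < n) a i * b i <= B.
Proof.
move=> a0 b0 /= asum /vanishing_bounded[M bM].
have [|B hB] := nneseries_bounded a0.
  by under eq_eseriesr do rewrite -[a _]powRr1//.
exists (B * M) => n; have M0 : 0 <= M by apply: le_trans (bM 0%N).
apply: le_trans (ler_wpM2r M0 (hB n)); rewrite mulr_suml; apply: ler_sum => i _.
by rewrite ler_wpM2l//; have := bM i; rewrite ger0_norm.
Qed.

(** Young's inequality for finite exponents; otherwise one sequence is summable
    and the other is bounded. *)
Lemma hoelder_bounded (p q : \bar R) (a b : nat -> R) : (1 <= p)%E -> (1 <= q)%E ->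
  (p^-1 + q^-1 = 1)%E -> (forall i, 0 <= a i) -> (forall i, 0 <= b i) ->
  vanishing a -> vanishing b -> power_summable p a -> power_summable q b ->
  exists B : R, forall n, \sum_(i < n) a i * b i <= B.
Proof.
move=> p1 q1 pq a0 b0 av bv.
case: p p1 pq => [r| |//]; rewrite ?lee_fin => r1.
- have rn0 : r != 0 by rewrite gt_eqF// (lt_le_trans _ r1).
  rewrite inver (negPf rn0); case: q q1 => [s| |//]; rewrite ?lee_fin => s1.
    have sn0 : s != 0 by rewrite gt_eqF// (lt_le_trans _ s1).
    rewrite inver (negPf sn0) -EFinD => -[rs] /= ha hb.
    have [|Ba hBa] := nneseries_bounded _ ha; first by move=> i; exact: powR_ge0.
    have [|Bb hBb] := nneseries_bounded _ hb; first by move=> i; exact: powR_ge0.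
    exists (Ba / r + Bb / s) => n.
    apply: (@le_trans _ _ (\sum_(i < n) (a i `^ r / r + b i `^ s / s))).
      by apply: ler_sum => i _; apply: conjugate_powR => //; apply: lt_le_trans ltr01 _.
    rewrite big_split/= -!mulr_suml.
    by apply: lerD; rewrite ler_wpM2r ?invr_ge0 ?(le_trans ler01)// ?hBa ?hBb.
  rewrite invey adde0 => -[/(congr1 GRing.inv)]; rewrite invrK invr1 => -> ha _.
  exact: summable_mul_bounded.
- case: q q1 => [s| |//]; rewrite ?lee_fin => s1; last first.
    by rewrite invey adde0 => /eqP; rewrite eq_sym onee_eq0.
  have sn0 : s != 0 by rewrite gt_eqF// (lt_le_trans _ s1).
  rewrite invey add0e inver (negPf sn0) => -[/(congr1 GRing.inv)]; rewrite invrK invr1 => -> _ hb.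
  have [B hB] := summable_mul_bounded b0 a0 hb av.
  by exists B => n; under eq_bigr do rewrite mulrC; exact: hB.
Qed.

End Summability.

(** * The extremal values *)

Section Supremum.
Context {R : realType} {H : completeNormedModType R[i]}.
Variable dot : {dot H for Num.conj}.
Hypothesis norm_dot : forall x : H, `|x| ^+ 2 = dot x x.
Local Notation "''[' u , v ]" := (dot u%R v%R) : ring_scope.
Hypotheses (sepH : separable_space H) (infH : infinite_dimensional H).

(** Bases exist, so a trace is a limit along some sequence and hence unique. *)
Lemma traceE A (tau : R[i]) : is_trace dot A tau -> trace dot A = tau.
Proof.
move=> Atau; rewrite /trace.
apply: (@get_unique _ [set t : R[i]^o | is_trace dot A t] tau Atau) => t At.
have [e eb] := orthonormal_basis_exists norm_dot infH sepH.
have /(cvg_tendsP (H := R[i]^o)) h1 := Atau e eb.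
have /(cvg_tendsP (H := R[i]^o)) h2 := At e eb.
exact: tends_unique h2 h1.
Qed.

Lemma is_traceN A (tau : R[i]) : is_trace dot A tau -> is_trace dot (fun x => - A x) (- tau).
Proof.
move=> Atau e /Atau /(cvg_tendsP (H := R[i]^o)) h; apply/(cvg_tendsP (H := R[i]^o)).
have := tendsN h; congr tends; apply/funext => n.
by rewrite -sumrN; apply: eq_bigr => i _; rewrite dotNl.
Qed.

Variables (C T : H -> H) (c t : nat -> R) (f g : nat -> H).
Hypotheses (of_ : orthonormal_seq dot f) (og : orthonormal_seq dot g).
Hypotheses (Cd : diagonal dot C c f) (Td : diagonal dot T t g).
Hypotheses (cm : nonincreasing_seq (fun i => `|c i|))
           (tm : nonincreasing_seq (fun i => `|t i|)).
Hypotheses (cv : vanishing c) (tv : vanishing t).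
Variable B : R.
Hypothesis ctB : forall n, \sum_(k < n) `|c k| * `|t k| <= B.
Variables (sp sn tp tn : nat -> nat).
Hypotheses (hsp : sorts (posp c) sp) (hsn : sorts (negp c) sn).
Hypotheses (htp : sorts (posp t) tp) (htn : sorts (negp t) tn).

Let orbit (U : H -> H) := C \o adjoint dot U \o T \o U.

Lemma orbit_trace U V : unitary_pair dot U V -> exists tau : R,
  [/\ tends (fun n => \sum_(i < n) trace_term dot (V \o T \o U) c f id i) tau%:C,
      is_trace dot (orbit U) tau%:C & complex.Re (trace dot (orbit U)) = tau].
Proof.
move=> UV; have Td' := conjugate_diagonal norm_dot UV Td.
have oV := conjugate_orthonormal UV og.
have [tau htau] := trace_terms_lim norm_dot of_ oV Td' cm tm ctB.
have it : is_trace dot (orbit U) tau%:C.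
  rewrite /orbit (unitary_pair_adjoint norm_dot UV).
  exact: (trace_expansion norm_dot of_ oV Cd Td' cm tm cv ctB htau).
by exists tau; split=> //; rewrite (traceE it).
Qed.

Let term := upper_term c t sp sn tp tn.

Let term_ge0 k : 0 <= term k.
Proof. by rewrite /term /upper_term addr_ge0// mulr_ge0 ?posp_ge0 ?negp_ge0. Qed.

Lemma orbit_supremum :
  ereal_sup [set (complex.Re (trace dot (orbit U)))%:E | U in [set U | unitary dot U]] =
  (\sum_(0 <= j <oo) (term j)%:E)%E.
Proof.
have partial N : ((\sum_(k < N) term k)%:E <= \sum_(0 <= j <oo) (term j)%:E)%E.
  rewrite -sumEFin -(big_mkord xpredT (fun i => (term i)%:E)).
  by apply: nneseries_lim_ge => i _ _; rewrite lee_fin.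
apply/eqP; rewrite eq_le; apply/andP; split.
  apply: ge_ereal_sup => _ [U /= Uu <-].
  have UV := unitary_pairP Uu; have [tau [htau _ ->]] := orbit_trace UV.
  have oV := conjugate_orthonormal UV og.
  have Td' := conjugate_diagonal norm_dot UV Td.
  case E : (\sum_(0 <= j <oo) (term j)%:E)%E => [r| |]; rewrite ?leey//.
    rewrite lee_fin; apply: (trace_upper norm_dot of_ oV Td' hsp hsn htp htn htau) => N.
    by have := partial N; rewrite E lee_fin.
  by have := partial 0%N; rewrite E big_ord0.
apply: lime_le; first by apply: is_cvg_nneseries => n _ _; rewrite lee_fin.
near=> N; rewrite big_mkord sumEFin; apply/lee_addgt0Pr => e e0.
have [U [V [tau [UV htau h]]]] :=
  trace_approach norm_dot of_ og Td cm tm cv tv ctB hsp hsn htp htn N e0.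
have [tau' [htau' _ tr]] := orbit_trace UV.
have tt : tau' = tau by apply: complexI; exact: tends_unique htau' htau.
apply: (@le_trans _ _ (tau%:E + e%:E)%E).
  by rewrite -EFinD lee_fin -lerBlDr.
rewrite leeD2r//; apply: ereal_sup_ubound; exists U; first exact: unitary_pair_unitary UV.
by rewrite tr tt.
Unshelve. all: by end_near. Qed.

End Supremum.

Section Main.
Context {R : realType} {H : completeNormedModType R[i]}.
Variable dot : {dot H for Num.conj}.
Hypothesis norm_dot : forall x : H, `|x| ^+ 2 = dot x x.
Hypothesis infH : infinite_dimensional H.

Lemma schatten_diagonalization (p : \bar R) A : schatten dot p A -> selfadjoint dot A ->
  exists (a : nat -> R) (f : nat -> H) (s s' : nat -> nat),
  [/\ orthonormal_seq dot f, diagonal dot A a f, vanishing a,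
      nonincreasing_seq (fun i => `|a i|) & power_summable p (fun i => `|a i|)] /\
  [/\ sorts (posp a) s, sorts (negp a) s', eigenvalue_seq (pos_part dot A) = posp a \o s &
      eigenvalue_seq (neg_part dot A) = negp a \o s'].
Proof.
move=> [Ac Ap] Asa; have [Al _] := Ac.
have As := selfadjoint_symmetric Al Asa.
have [a [f [of_ Ad av am]]] := spectral_theorem norm_dot infH Ac As.
have [M aM] := vanishing_bounded av.
have pd := pos_part_diagonal norm_dot of_ Ad Asa aM.
have nd := neg_part_diagonal norm_dot of_ Ad Asa aM.
have pv : vanishing (posp a).
  by apply: vanishing_le av => i; rewrite ger0_norm ?posp_ge0 ?posp_le.
have nv : vanishing (negp a).
  by apply: vanishing_le av => i; rewrite ger0_norm ?negp_ge0 ?negp_le.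
have [s [sI sE sm sc]] := eigenvalue_seq_rearrangement norm_dot of_ pd pv (posp_ge0 a).
have [s' [sI' sE' sm' sc']] := eigenvalue_seq_rearrangement norm_dot of_ nd nv (negp_ge0 a).
have absE : singular_numbers dot A = fun i => `|a i|.
  apply: (eigenvalue_seqE norm_dot of_ (abs_op_diagonal norm_dot of_ Ad Asa aM)) => //.
  by apply: vanishing_le av => i; rewrite normr_id.
by exists a, f, s, s'; split; split=> //; rewrite -absE.
Qed.

End Main.

Theorem theorem3p4 (R : realType) (H : completeNormedModType R[i])
  (dot : {dot H for Num.conj})
  (norm_dot : forall x : H, `|x| ^+ 2 = dot x x)
  (sepH : separable_space H) (infH : infinite_dimensional H)
  (p q : \bar R) (p1 : (1 <= p)%E) (q1 : (1 <= q)%E)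
  (pq : (p^-1 + q^-1 = 1)%E)
  (C T : H -> H) (Cp : schatten dot p C) (Tq : schatten dot q T)
  (Csa : selfadjoint dot C) (Tsa : selfadjoint dot T) :
  let conjT (U : H -> H) := C \o adjoint dot U \o T \o U in
  let lam := @eigenvalue_seq R H in
  let Cplus := pos_part dot C in let Cminus := neg_part dot C in
  let Tplus := pos_part dot T in let Tminus := neg_part dot T in
  let upper : \bar R := (\sum_(0 <= j <oo)
    (lam Cplus j * lam Tplus j + lam Cminus j * lam Tminus j)%:E)%E in
  let lower : \bar R := (- \sum_(0 <= j <oo)
    (lam Cplus j * lam Tminus j + lam Cminus j * lam Tplus j)%:E)%E in
  [/\ (* the traces below are well-defined real numbers *)
      forall U : H -> H, unitary dot U ->
        exists t : R, is_trace dot (conjT U) t%:C,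
      ereal_sup [set (complex.Re (trace dot (conjT U)))%:E |
                  U in [set U : H -> H | unitary dot U]] = upper,
      ereal_inf [set (complex.Re (trace dot (conjT U)))%:E |
                  U in [set U : H -> H | unitary dot U]] = lower &
      (lower <= (complex.Re (trace dot (C \o T)))%:E <= upper)%E].
Proof.
move=> conjT lam Cplus Cminus Tplus Tminus upper lower.
have [c [f [sp [sn [[of_ Cd cv cm cs] [hsp hsn eCp eCn]]]]]] :=
  schatten_diagonalization norm_dot infH Cp Csa.
have [t [g [tp [tn [[og Td tv tm ts] [htp htn eTp eTn]]]]]] :=
  schatten_diagonalization norm_dot infH Tq Tsa.
have [||B ctB] := hoelder_bounded p1 q1 pq (fun i => normr_ge0 (c i))
  (fun i => normr_ge0 (t i)) _ _ cs ts.
- by apply: vanishing_le cv => i; rewrite normr_id.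
- by apply: vanishing_le tv => i; rewrite normr_id.
have [Cs _ _] := Cd.
(* The infimum is minus the supremum for -T, whose positive and negative parts
   are exchanged. *)
pose T' x := - T x; pose t' i := - t i.
have Td' : diagonal dot T' t' g.
  have [Ts Tg T0] := Td; split.
  - by move=> x y; rewrite dotNl dotNr Ts.
  - by move=> i; rewrite /T' Tg /t' rmorphN scaleNr.
  - by move=> x /T0; rewrite /T' => ->; rewrite oppr0.
have tm' : nonincreasing_seq (fun i => `|t' i|).
  by move=> m n /tm; rewrite /t' !normrN.
have tv' : vanishing t' by apply: vanishing_le tv => i; rewrite normrN.
have ctB' n : \sum_(k < n) `|c k| * `|t' k| <= B.
  by under eq_bigr do rewrite normrN; exact: ctB.
have htp' : sorts (posp t') tn by rewrite pospN.
have htn' : sorts (negp t') tp by rewrite negpN.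
have trace_ex U : unitary dot U -> exists tau : R, is_trace dot (conjT U) tau%:C.
  move=> /unitary_pairP UV.
  by have [tau [_ ? _]] := orbit_trace norm_dot sepH infH of_ og Cd Td cm tm cv ctB UV; exists tau.
have supE : ereal_sup [set (complex.Re (trace dot (conjT U)))%:E |
    U in [set U : H -> H | unitary dot U]] = upper.
  rewrite (orbit_supremum norm_dot sepH infH of_ og Cd Td cm tm cv tv ctB hsp hsn htp htn).
  by apply: eq_eseriesr => k _; rewrite /lam eCp eCn eTp eTn.
have infE : ereal_inf [set (complex.Re (trace dot (conjT U)))%:E |
    U in [set U : H -> H | unitary dot U]] = lower.
  rewrite /ereal_inf /lower; congr (- _)%E.
  transitivity (ereal_sup [set (complex.Re (trace dot (C \o adjoint dot U \o T' \o U)))%:E |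
      U in [set U : H -> H | unitary dot U]]).
    have key U : unitary dot U -> complex.Re (trace dot (C \o adjoint dot U \o T' \o U)) =
        - complex.Re (trace dot (conjT U)).
      move=> Uu; have [tau htau] := trace_ex _ Uu.
      have -> : C \o adjoint dot U \o T' \o U = (fun x => - conjT U x).
        apply/funext => x /=; rewrite /T' -(sym_opp norm_dot Cs); congr (C _).
        have [UV _ _] := unitary_pairP Uu.
        by apply: (dot_inj norm_dot) => z; rewrite dotNl !(dotC dot _ z) -!UV dotNr rmorphN.
      rewrite (traceE norm_dot sepH infH htau).
      by rewrite (traceE norm_dot sepH infH (is_traceN htau)) raddfN.
    congr ereal_sup; apply/seteqP; split.
      by move=> _ [_ [U Uu <-] <-]; exists U => //; rewrite key.
    move=> _ [U Uu <-]; exists (complex.Re (trace dot (conjT U)))%:E; first by exists U.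
    by rewrite key.
  rewrite (orbit_supremum norm_dot sepH infH of_ og Cd Td' cm tm' cv tv' ctB' hsp hsn htp' htn').
  by apply: eq_eseriesr => k _; rewrite /lam eCp eCn eTp eTn /upper_term pospN negpN.
split=> //.
have idu := unitary_pair_id dot.
have CT : conjT id = C \o T by rewrite /conjT (unitary_pair_adjoint norm_dot idu).
rewrite -CT -supE -infE; apply/andP; split.
  by apply: ereal_inf_lbound; exists id => //; exact: (unitary_pair_unitary norm_dot idu).
by apply: ereal_sup_ubound; exists id => //; exact: (unitary_pair_unitary norm_dot idu).
Qed.
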